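(* For all integers $n\ge 30$, $ar_{\mathcal{P}}(n, M_6)=2n+3$.
   Context: All graphs are finite and simple. $M_6$ denotes a matching with $6$ edges (six pairwise disjoint edges). A subgraph of an edge-colored graph is rainbow if all of its edges have distinct colors. For a planar graph $H$ and an integer $n\ge |H|$, let $\mathcal{T}_n(H)$ be the family of all plane triangulations on $n$ vertices that contain a subgraph isomorphic to $H$. The planar anti-Ramsey number $ar_{\mathcal{P}}(n,H)$ is the maximum number of colors in an edge-coloring of a plane triangulation $T\in\mathcal{T}_n(H)$ such that $T$ contains no rainbow copy of $H$. *)

(* Defs.v *)
From mathcomp Require Import all_boot perm.

Set Implicit Arguments.
Unset Strict Implicit.
Unset Printing Implicit Defensive.

Record sgraph := SGraph {
  vertex :> finType;
  adj : rel vertex;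
  adj_sym : symmetric adj;
  adj_irrefl : irreflexive adj }.

Definition edges (G : sgraph) : {set {set G}} :=
  [set [set p.1; p.2] | p : G * G & adj p.1 p.2].

Definition dart (G : sgraph) : finType := {p : G * G | adj p.1 p.2}.

Definition source (G : sgraph) (d : dart G) : G := (val d).1.

Lemma rev_subproof (G : sgraph) (d : dart G) :
  adj (val d).2 (val d).1.
Proof. by rewrite adj_sym; exact: valP d. Qed.

Definition rev (G : sgraph) (d : dart G) : dart G :=
  exist (fun p : G * G => adj p.1 p.2)
        ((val d).2, (val d).1) (rev_subproof d).

(* A rotation system, the combinatorial form of a cellular embedding in an
   oriented closed surface: [rot] permutes cyclically the darts leaving each
   vertex. *)
Definition rotation_system (G : sgraph) (rot : {perm dart G}) : Prop :=
  forall d d' : dart G, fconnect rot d d' = (source d == source d').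

(* The faces of the embedding are the orbits of [face_step rot]: walk along a
   dart, then leave its head by the dart following the reversed one. *)
Definition face_step (G : sgraph) (rot : {perm dart G}) (d : dart G) : dart G :=
  rot (rev d).

Definition nb_faces (G : sgraph) (rot : {perm dart G}) : nat :=
  fcard (face_step rot) (dart G).

(* The surface carrying a connected map is the sphere exactly when Euler's
   formula holds.  The outer face of the plane is one of the faces, so it is a
   triangle too; in a simple graph a closed face walk of length 3 is a
   triangle. *)
Record plane_triangulation := PlaneTriangulation {
  pt_graph :> sgraph;
  pt_rot : {perm dart pt_graph};
  pt_rotation : rotation_system pt_rot;
  pt_order : 3 <= #|pt_graph|;
  pt_connected : forall x y : pt_graph, connect (@adj pt_graph) x y;
  pt_euler : #|pt_graph| + nb_faces pt_rot = #|edges pt_graph| + 2;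
  pt_faces : forall d : dart pt_graph, order (face_step pt_rot) d = 3 }.

(* The copies of [H] in [G], as not necessarily induced subgraphs, are the
   images of these maps. *)
Definition embedding (H G : sgraph) (f : H -> G) : Prop :=
  injective f /\ (forall x y : H, adj x y -> adj (f x) (f y)).

Definition contains (G H : sgraph) : Prop :=
  exists f : H -> G, embedding f.

Definition triangulation_family (n : nat) (H : sgraph)
    (T : plane_triangulation) : Prop :=
  #|T| = n /\ contains T H.

(* Only the values of [c] on edges matter; all [k] colors must occur. *)
Definition edge_coloring (G : sgraph) (k : nat) (c : {set G} -> 'I_k) : Prop :=
  forall i : 'I_k, exists2 e : {set G}, e \in edges G & c e = i.

Definition has_rainbow (G H : sgraph) (C : Type) (c : {set G} -> C) : Prop :=
  exists f : H -> G,
    embedding f /\ {in edges H &, injective (fun e : {set H} => c (f @: e))}.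

Definition colors_avoiding (n : nat) (H : sgraph) (k : nat) : Prop :=
  exists T : plane_triangulation, triangulation_family n H T /\
    exists c : {set T} -> 'I_k, edge_coloring c /\ ~ has_rainbow H c.

Definition is_planar_anti_ramsey (n : nat) (H : sgraph) (k : nat) : Prop :=
  colors_avoiding n H k /\
  (forall k' : nat, colors_avoiding n H k' -> k' <= k).

Definition matching_adj (k : nat) : rel ('I_k * bool) :=
  fun u v => (u.1 == v.1) && (u.2 != v.2).

Lemma matching_adj_sym (k : nat) : symmetric (@matching_adj k).
Proof. by move=> u v; rewrite /matching_adj eq_sym (eq_sym u.2). Qed.

Lemma matching_adj_irrefl (k : nat) : irreflexive (@matching_adj k).
Proof. by move=> u; rewrite /matching_adj !eqxx. Qed.

Definition matching (k : nat) : sgraph :=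
  SGraph (@matching_adj_sym k) (@matching_adj_irrefl k).

(* Main.v *)
(* Upper bound.  With at least 2n+4 colours, keep one edge of each colour; the
   resulting graph G is planar and, if there is no rainbow M_6, has matching
   number at most 5.  The Gallai-Edmonds theorem yields a set S and a matching m
   of G - S, with |S| + |m| <= 5, leaving at most one vertex uncovered in each
   component of G - S.  Euler's formula applied to G - S, the faces meeting S
   lying in few of its regions, bounds the number of edges of G and rules out
   |S| <= 3; for |S| = 4 it forces S to span a K_4 and G - S to have a single
   nontrivial component, on three vertices and with at least two edges.  In both
   remaining cases W, the union of S and that component, has at most 15 - 2|S|
   vertices, at most |S| - 2 vertices of S have fewer than eight neighbours
   outside W, and planarity makes every set A of them have at least |A| + 1
   neighbours outside W.  A set Y of at most 2(|S| - 2) vertices retains this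
   surplus.  As W and Y have at most 11 vertices together and n >= 30, some edge
   f of T avoids them all; whichever edge of G has the colour of f, Hall's
   theorem provides five disjoint edges of G that avoid it and f.

   Lower bound.  Some triangulation has 2n+2 edges meeting a set S of four
   vertices; give them distinct colours, and one further colour to all other
   edges.  A rainbow matching then has at most five edges. *)
Require Import Defs.
From mathcomp Require Import all_boot perm.
From mathcomp Require Import zify.

Set Implicit Arguments.
Unset Strict Implicit.
Unset Printing Implicit Defensive.


(** * Components of a relation after the addition of one edge *)

Section AddEdge.

Variables (V : finType) (e e' : rel V) (x y : V).
Hypothesis e_sym : symmetric e.
Hypothesis e'E : forall u v,
  e' u v = [|| e u v, (u == x) && (v == y) | (u == y) && (v == x)].

Lemma add_edge_sym : symmetric e'.
Proof.
move=> u v; rewrite !e'E e_sym (orbC (_ && _)).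
by congr [|| _, _ | _]; rewrite andbC. Qed.

Lemma sub_add_edge u v : connect e u v -> connect e' u v.
Proof. by apply: connect_sub => a b ab; apply: connect1; rewrite e'E ab. Qed.

(** Induction along the path: each of the three alternatives survives the addition of an old or new
    edge in front, since repeated uses of the new edge can be shortcut. *)
Lemma connect_add_edge u v :
  connect e' u v -> [|| connect e u v, connect e u x && connect e y v
                      | connect e u y && connect e x v].
Proof.
have cs := sym_connect_sym e_sym.
case/connectP=> p; elim: p u => [|w p IH] u /=; first by move=> _ ->; rewrite connect0.
case/andP=> uw pw vE.
move: (IH w pw vE) uw; rewrite e'E => IHw uw; move: IHw.
case/or3P: uw => [uw|/andP[/eqP-> /eqP->]|/andP[/eqP-> /eqP->]].
- have c := connect1 uw.
  case/or3P=> [wv|/andP[wx ->]|/andP[wy ->]].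
  + by rewrite (connect_trans c wv).
  + by rewrite (connect_trans c wx) orbT.
  + by rewrite (connect_trans c wy) !orbT.
- rewrite !connect0 /=.
  by case/or3P=> [->|/andP[_ ->]|->]; rewrite ?orbT.
- rewrite !connect0 /=.
  by case/or3P=> [->|->|/andP[_ ->]]; rewrite ?orbT.
Qed.

Lemma n_comp_add_edge_connected : connect e x y -> n_comp e' V = n_comp e V.
Proof.
move=> xy; apply/esym/eq_n_comp => u v; apply/idP/idP; first exact: sub_add_edge.
have yx : connect e y x by rewrite (sym_connect_sym e_sym).
case/connect_add_edge/or3P => [//|/andP[ux yv]|/andP[uy xv]].
  by apply: connect_trans ux (connect_trans xy yv).
by apply: connect_trans uy (connect_trans yx xv).
Qed.

(** The new edge merges only the components of [x] and [y]. Hence the old roots other than that of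
    [y] still have distinct roots. *)
Lemma n_comp_add_edge : n_comp e V <= n_comp e' V + 1.
Proof.
have cs := sym_connect_sym e_sym.
have cs' := sym_connect_sym add_edge_sym.
pose A := [set r | roots e r].
pose B := [set r | roots e' r].
have -> : n_comp e V = #|A|.
  by rewrite /n_comp_mem cardsE; apply: eq_card => r; rewrite !inE andbT.
have -> : n_comp e' V = #|B|.
  by rewrite /n_comp_mem cardsE; apply: eq_card => r; rewrite !inE andbT.
rewrite (cardsD1 (root e y) A) addnC leq_add ?leq_b1 //.
rewrite -(card_in_imset (f := root e')); last first.
  move=> r1 r2; rewrite !inE => /andP[r1y /eqP R1] /andP[r2y /eqP R2].
  move/eqP; rewrite (root_connect cs') => /connect_add_edge.
  case/or3P=> [r12|/andP[_ yr]|/andP[ry _]].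
  - by rewrite -R1 -R2; apply/eqP; rewrite root_connect.
  - by case/eqP: r2y; rewrite -R2; apply/eqP; rewrite root_connect // cs.
  - by case/eqP: r1y; rewrite -R1; apply/eqP; rewrite root_connect // cs.
apply: subset_leq_card; apply/subsetP=> _ /imsetP[r _ ->].
by rewrite inE; apply: roots_root.
Qed.

End AddEdge.

(** * Euler's formula for the subgraphs of a triangulation *)

(** Edges are counted as ordered pairs throughout, so that every edge counts twice and pairs match
    darts. *)
Definition npairs (V : finType) (h : rel V) := #|[set p : V * V | h p.1 p.2]|.

Lemma card_edge_pairs (G : sgraph) (F : {set {set G}}) : F \subset edges G ->
  #|[set p : G * G | adj p.1 p.2 && ([set p.1; p.2] \in F)]| = 2 * #|F|.
Proof.
move=> FG; rewrite -[LHS]sum1_card.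
rewrite (partition_big (fun p => [set p.1; p.2]) (mem F)) /=; last first.
  by move=> p; rewrite inE => /andP[].
rewrite (eq_bigr (fun=> 2)); first by rewrite sum_nat_const mulnC.
move=> e eF; have /imsetP[[x y]] := subsetP FG _ eF; rewrite inE /= => xy eE.
rewrite eE in eF *.
have nxy : x != y by apply: contraTneq xy => ->; rewrite adj_irrefl.
rewrite sum1_card; rewrite -[RHS](_ : #|[set (x, y); (y, x)]| = 2); last first.
  by rewrite cards2 xpair_eqE (negPf nxy).
apply: eq_card => [[a b]]; rewrite !inE unfold_in /= !inE /= !xpair_eqE.
apply/andP/orP.
  case=> /andP[ab _] /eqP E.
  have : a \in [set x; y] by rewrite -E !inE eqxx.
  have : b \in [set x; y] by rewrite -E !inE eqxx orbT.
  rewrite !inE => /orP[] /eqP eb /orP[] /eqP ea; move: ab;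
    rewrite ea eb ?adj_irrefl // !eqxx; auto.
case=> /andP[/eqP-> /eqP->]; first by rewrite xy eF eqxx.
by rewrite adj_sym xy setUC eF eqxx.
Qed.

Section Regions.

Variable T : plane_triangulation.
Local Notation D := (dart T).
Local Notation rev := (@Defs.rev T).
Local Notation rot := (@pt_rot T).
Local Notation phi := (face_step rot).

Definition target (d : D) : T := (val d).2.

Lemma source_rev (d : D) : source (rev d) = target d. Proof. by []. Qed.
Lemma target_rev (d : D) : target (rev d) = source d. Proof. by []. Qed.

Lemma dart_adj (d : D) : adj (source d) (target d).
Proof. exact: valP d. Qed.

Lemma dart_inj (d d' : D) : source d = source d' -> target d = target d' -> d = d'.
Proof.
by move=> s t; apply: val_inj;
  rewrite [LHS]surjective_pairing [RHS]surjective_pairing; congr pair.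
Qed.

Lemma revK : involutive (rev).
Proof. by move=> d; apply: dart_inj. Qed.

Lemma source_rot (d : D) : source (rot d) = source d.
Proof. by apply/esym/eqP; rewrite -(pt_rotation d); apply: fconnect1. Qed.

Lemma source_phi (d : D) : source (phi d) = target d.
Proof. by rewrite source_rot. Qed.

Lemma phi_rev (d : D) : phi (rev d) = rot d.
Proof. by rewrite /face_step revK. Qed.

Lemma phi_inj : injective phi.
Proof. exact: inj_comp perm_inj (inv_inj revK). Qed.

Lemma phi3 (d : D) : phi (phi (phi d)) = d.
Proof. by have := iter_order phi_inj d; rewrite pt_faces. Qed.

Lemma dart_of (x y : T) : adj x y -> exists d : D, source d = x /\ target d = y.
Proof. by move=> xy; exists (exist _ (x, y) xy). Qed.

Section Sided.

Variable R : {set D}.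
Hypothesis phiR : forall d, (phi d \in R) = (d \in R).

(** The boundary of [R], a union of faces: the edges with [R] on exactly one side, in both
    directions. *)
Definition sided (d : D) := (d \in R) != (rev d \in R).

Lemma sided_rev d : sided (rev d) = sided d.
Proof. by rewrite /sided revK eq_sym. Qed.

Lemma sidedE d : sided d = ((d \in R) != (rot d \in R)).
Proof. by rewrite /sided -(phiR (rev d)) phi_rev. Qed.

(* Going once around a vertex, one enters [R] as often as one leaves it. *)
Lemma sided_even v : ~~ odd #|[set d | (source d == v) && sided d]|.
Proof.
pose A := [set d | source d == v].
pose B := [set d in A | d \in R].
pose C := [set d in A | rot d \in R].
have BC : #|B| = #|C|.
  have <- : rot @^-1: B = C.
    by apply/setP=> d; rewrite !inE source_rot.
  by rewrite card_preimset //; apply: perm_inj.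
have -> : [set d | (source d == v) && sided d] = (B :\: C) :|: (C :\: B).
  apply/setP=> d; rewrite !inE sidedE.
  by case: (source d == v); case: (d \in R); case: (_ \in R).
rewrite cardsU (_ : _ :&: _ = set0) ?cards0 ?subn0; last first.
  by apply/setP=> d; rewrite !inE; case: (_ == _); case: (d \in R); case: (_ \in R).
by rewrite !cardsD BC setIC addnn odd_double.
Qed.

(** Reversal exchanges the boundary darts inside [R] with those outside. *)
Lemma card_sided (P : pred D) : (forall d, P (rev d) = P d) ->
  #|[set d | P d && sided d]| = 2 * #|[set d in R | P d && sided d]|.
Proof.
move=> Prev; pose A := [set d | P d && sided d].
rewrite -/A -(cardsID R A) mul2n -addnn; congr (_ + _).
  by apply: eq_card => d; rewrite !inE andbC.
rewrite -(card_preimset (f := rev)); last exact: inv_inj revK.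
apply: eq_card => d; rewrite !inE Prev sided_rev /sided.
by case: (P d); case: (d \in R); case: (_ \in R).
Qed.

Lemma sided_other d : sided d ->
  exists d', [/\ sided d', source d' = source d & target d' != target d].
Proof.
move=> sd; have := sided_even (source d).
rewrite (cardsD1 d) !inE eqxx sd /= negbK.
case: (set_0Vmem ([set e | (source e == source d) && sided e] :\ d)) => [->|].
  by rewrite cards0.
case=> e; rewrite !inE => /and3P[ed /eqP es se] _; exists e; split=> //.
by apply: contraNneq ed => et; apply/eqP/dart_inj.
Qed.

End Sided.

(** Closure under [phi] and [rev] gives closure under [rot], so [R] spreads around each vertex and
    along each edge; [T] is connected. *)
Lemma dart_set_full (R : {set D}) d0 :
  (forall d, (phi d \in R) = (d \in R)) ->
  (forall d, (rev d \in R) = (d \in R)) -> d0 \in R -> R = setT.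
Proof.
move=> phiR revR d0R.
have rotR d : (rot d \in R) = (d \in R) by rewrite -phi_rev phiR revR.
have sR d d' : d \in R -> source d = source d' -> d' \in R.
  move=> dR ss; have : fconnect rot d d' by rewrite pt_rotation ss.
  case/iter_findex; move: (findex _ _ _) => i <-.
  by elim: i => //= i; rewrite rotR.
apply/setP=> d; rewrite inE.
have /connectP[p] := pt_connected (source d0) (source d).
elim: p d0 d0R => [|y p IH] e eR /=; first by move=> _ /esym; apply: sR.
case/andP=> ey py pE; have [f [fs ft]] := dart_of ey.
apply: (IH (rev f)); first by rewrite revR; apply: sR eR _.
all: by rewrite source_rev ft.
Qed.

(* The classes of [region h] are the faces of the subgraph [h], as unions of
   faces of [T] glued along the edges of [T] outside [h]. *)
Definition region (h : rel T) : rel D := fun d d' =>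
  [|| d' == phi d, d == phi d' | (d' == rev d) && ~~ h (source d) (target d)].

Lemma region_sym h : symmetric h -> symmetric (region h).
Proof.
move=> hs d d'; rewrite /region orbA (orbC (d' == _)) -orbA; congr [|| _, _ | _].
rewrite (eq_sym d' (rev d)) (inv_eq revK).
by case: eqP => //= ->; rewrite source_rev target_rev hs.
Qed.

Section OneRegion.
Variables (h : rel T) (d0 : D).
Hypothesis h_sym : symmetric h.
Let R := [set d | connect (region h) d0 d].

Lemma region_phi d : (phi d \in R) = (d \in R).
Proof.
rewrite !inE; apply/esym/(connect_closed (sym_connect_sym (region_sym h_sym))).
by rewrite /region eqxx.
Qed.

Lemma region_sided d : sided R d -> h (source d) (target d).
Proof.
apply: contraTT => nh; rewrite /sided !inE negbK; apply/eqP.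
apply: (connect_closed (sym_connect_sym (region_sym h_sym))).
by rewrite /region eqxx nh !orbT.
Qed.
End OneRegion.

(** A bridge has the same region on both sides. Otherwise consider the boundary darts of the region
    of [d0] that start in the component [P] of its source. They are even in number at every vertex,
    and those ending in [P] pair up under [rev]; but [d0] is the only remaining one. *)
Lemma region_bridge (h h' : rel T) (d0 : D) : symmetric h -> symmetric h' ->
  (forall u v, h' u v -> h u v \/ (u = source d0 /\ v = target d0)
                              \/ (v = source d0 /\ u = target d0)) ->
  ~~ connect h (source d0) (target d0) -> connect (region h') d0 (rev d0).
Proof.
move=> hs hs' hh' nc; apply/negPn/negP => nr.
pose R := [set d | connect (region h') d0 d].
have phiR : forall d, (phi d \in R) = (d \in R) by exact: region_phi.
pose P := [set v | connect h (source d0) v].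
pose O := [set d | (source d \in P) && sided R d].
have : ~~ odd #|O|.
  have -> : #|O| = \sum_(v in P) #|[set d | (source d == v) && sided R d]|.
    rewrite -sum1_card (partition_big (@source T) (mem P)) /=; last first.
      by move=> d; rewrite inE => /andP[].
    apply: eq_bigr => v vP; rewrite -sum1_card; apply: eq_bigl => d.
    by move: vP; rewrite !inE => vP; case: eqP => [->|]; rewrite ?andbF // vP andbT.
  elim/big_ind: _ => // [a b|v _]; last exact: sided_even.
  by rewrite oddD => /negPf-> /negPf->.
pose O1 := [set d | ((source d \in P) && (target d \in P)) && sided R d].
have -> : O = d0 |: O1.
  apply/setP=> d; rewrite !inE; apply/andP/orP.
    case=> sP sd; case tP: (connect h (source d0) (target d)).
      by right; rewrite sP sd.
    left; apply/eqP; case: (hh' _ _ (region_sided hs' sd)) => [hst|].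
      by rewrite (connect_trans sP (connect1 hst)) in tP.
    case=> [] [s t]; first exact: dart_inj.
    by rewrite s connect0 in tP.
  case=> [/eqP->|/andP[/andP[-> _] ->]] //.
  by rewrite connect0 /sided !inE connect0 (negPf nr).
rewrite cardsU1 !inE (negPf nc) andbF /=.
rewrite (@card_sided R (fun d => (source d \in P) && (target d \in P))) //.
  by rewrite mul2n /= odd_double.
by move=> d; rewrite source_rev target_rev andbC.
Qed.

Lemma npairs_adj : npairs (@adj T) = #|D|.
Proof. by rewrite /npairs cardsE card_sig. Qed.

Lemma card_edges : 2 * #|edges T| = #|D|.
Proof.
rewrite -npairs_adj -card_edge_pairs //; apply: eq_card => p; rewrite !inE.
by case: (boolP (adj _ _)) => //= pa; apply/imsetP; exists p; rewrite ?inE.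
Qed.

(** Every face has three darts, so Euler's formula leaves [3n - 6] edges. *)
Lemma card_dart : #|D| + 12 = 6 * #|T|.
Proof.
have e2 := card_edges; have eu := pt_euler T.
have f3 : nb_faces rot * 3 = #|D|.
  apply: (fcard_order_set phi_inj); last by [].
  by apply/subsetP=> d _; rewrite inE pt_faces.
rewrite /nb_faces in eu f3; lia.
Qed.

Lemma nb_facesE : n_comp (region (@adj T)) D = nb_faces rot.
Proof.
apply: eq_n_comp => u v; apply/idP/idP.
  apply: connect_sub => a b; rewrite /region dart_adj andbF orbF.
  case/orP=> /eqP->; first exact: fconnect1.
  by rewrite fconnect_sym ?fconnect1 //; apply: phi_inj.
by apply: connect_sub => a b /eqP<-; apply: connect1; rewrite /region eqxx.
Qed.

(* Deleting edges one by one, starting from Euler's formula for [T]: an edge with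
   different regions on its two sides is not a bridge, so that no deletion both
   merges two regions and splits a component. *)
Lemma euler_sub (h : rel T) : symmetric h -> subrel h (@adj T) ->
  npairs h + 2 + 2 * n_comp h T <= 2 * #|T| + 2 * n_comp (region h) D.
Proof.
move: {2}(#|_|) (leqnn #|[set p : T * T | adj p.1 p.2 && ~~ h p.1 p.2]|) => m.
elim: m h => [|m IH] h le hs ha.
  have hE : forall x y, h x y = adj x y.
    move=> x y; apply/idP/idP=> [|xy]; first exact: ha.
    apply: contraLR le => nh; rewrite -ltnNge; apply/card_gt0P; exists (x, y).
    by rewrite inE /= xy nh.
  have -> : npairs h = npairs (@adj T).
    by apply: eq_card => p; rewrite !inE hE.
  have -> : n_comp h T = 1.
    rewrite (eq_n_comp (e' := @adj T)); last first.
      by move=> u v; apply: eq_connect => a b; rewrite hE.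
    have [x0 _] : exists x : T, true.
      have := pt_order T; case: (pickP (mem T)) => [x|/eq_card0->] //; by exists x.
    have := n_comp_connect (sym_connect_sym (@adj_sym T)) x0.
    by move<-; apply: eq_n_comp_r => y; rewrite !inE pt_connected.
  have -> : n_comp (region h) D = nb_faces rot.
    rewrite -nb_facesE; apply: eq_n_comp => u v; apply: eq_connect => a b.
    by rewrite /region hE.
  have := pt_euler T; have := card_edges; rewrite npairs_adj /nb_faces /=; lia.
case: (boolP [forall p : T * T, adj p.1 p.2 ==> h p.1 p.2]) => [/forallP hall|].
  apply: IH => //; rewrite (_ : [set _ | _] = set0) ?cards0 //.
  by apply/setP=> p; rewrite !inE; have := hall p; case: adj => //= ->.
case/forallPn=> [[x y]]; rewrite negb_imply /= => /andP[axy nh].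
have [d0 [sd0 td0]] := dart_of axy.
pose h' : rel T := fun u v => [|| h u v, (u == x) && (v == y) | (u == y) && (v == x)].
have h'E : forall u v, h' u v = [|| h u v, (u == x) && (v == y) | (u == y) &&
  (v == x)] by [].
have nyx : (y == x) = false.
  by apply/negP => /eqP E; rewrite E adj_irrefl in axy.
have hs' := add_edge_sym hs h'E.
have ha' : subrel h' (@adj T).
  by move=> u v /or3P[/ha //|/andP[/eqP-> /eqP->]|/andP[/eqP-> /eqP->]] //;
    rewrite adj_sym.
have pE : npairs h' = npairs h + 2.
  rewrite /npairs (_ : [set _ | _] = [set p | h p.1 p.2] :|: [set (x, y); (y, x)]).
    rewrite cardsU cards2 xpair_eqE (eq_sym x) nyx /= (_ : _ :&: _ = set0)
      ?cards0 ?subn0 //.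
    apply/setP=> [[a b]]; rewrite !inE /= !xpair_eqE; apply/negP => /andP[hab].
    case/orP=> /andP[/eqP ea /eqP eb]; move: hab; rewrite ea eb ?(negPf nh) //.
    by rewrite hs (negPf nh).
  by apply/setP=> [[a b]]; rewrite !inE /= !xpair_eqE.
have le' : #|[set p : T * T | adj p.1 p.2 && ~~ h' p.1 p.2]| <= m.
  rewrite -ltnS; apply: leq_trans le; apply: proper_card; apply/properP; split.
    apply/subsetP=> p; rewrite !inE /h' negb_or => /andP[-> /andP[-> _]] //.
  by exists (x, y); rewrite !inE /= ?axy ?nh // /h' !eqxx orbT.
have := IH h' le' hs' ha'; rewrite pE.
(* Dually, deleting the edge of [d0] from [h'] links [d0] to [rev d0] in the region graph, so
   [n_comp_add_edge] applies there too. *)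
have reE : forall u v, region h u v = [|| region h' u v, (u == d0) && (v == rev d0)
                                       | (u == rev d0) && (v == d0)].
  move=> u v; rewrite /region -!orbA; congr [|| _, _ | _].
  have key (d e : D) : (d == e) = (source d == source e) && (target d == target e).
    apply/eqP/andP => [->|[/eqP s /eqP t]]; [by rewrite !eqxx | exact: dart_inj].
  case: (altP (v =P rev u)) => [->|nv] /=.
    rewrite /h' negb_or !key !source_rev !target_rev sd0 td0.
    case: (altP (source u =P x)) => [->|_] /=.
      case: (altP (target u =P y)) => [->|_] /=; first by rewrite (negPf nh) orbT.
      by rewrite (eq_sym x) nyx /= andbT !orbF.
    case: (altP (source u =P y)) => [->|_] /=; last by rewrite andbT !orbF.
    case: (altP (target u =P x)) => [->|_] /=; last by rewrite andbT !orbF.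
    by rewrite hs nh orbT.
  apply/esym/negP => /orP[] /andP[/eqP uE /eqP vE]; move: nv;
    rewrite uE vE ?revK eqxx //.
have rs' := region_sym hs'.
have := n_comp_add_edge rs' reE; have := n_comp_add_edge hs h'E.
(* Either the edge closes a cycle and the components stay the same, or it is a bridge of [h'] and
   the regions stay the same. *)
case: (boolP (connect h x y)) => [c|nc].
  rewrite (n_comp_add_edge_connected hs h'E c).
  move: (npairs h) #|T| (n_comp h T) (n_comp (region h) D) (n_comp (region h') D); lia.
rewrite (n_comp_add_edge_connected rs' reE); first by move: (npairs h)
  #|T| (n_comp h T) (n_comp h' T) (n_comp (region h') D); lia.
apply: (region_bridge hs hs'); last by rewrite sd0 td0.
move=> a b /or3P[|/andP[/eqP-> /eqP->]|/andP[/eqP-> /eqP->]]; rewrite sd0 td0; auto.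
Qed.

End Regions.

(** * Edge bounds *)

(** Edges inside [P] count twice in [pairs_between h P P], whereas edges between disjoint sets count
    once. *)
Definition pairs_between (V : finType) (h : rel V) (P Q : {set V}) :=
  #|[set p : V * V | [&& h p.1 p.2, p.1 \in P & p.2 \in Q]]|.

Section PairsBetween.
Variables (V : finType) (h : rel V).
Implicit Types P Q R : {set V}.
Local Notation dd := (pairs_between h).

Lemma pairs_between_sum P Q :
  dd P Q = \sum_(x in P) #|[set y in Q | h x y]|.
Proof.
rewrite /pairs_between -sum1_card (partition_big (fun p => p.1) (mem P)) /=; last first.
  by move=> p; rewrite inE => /and3P[].
apply: eq_bigr => x xP; rewrite -sum1_card.
rewrite (reindex_onto (fun y => (x, y)) (fun p => p.2)) /=; last first.
  by move=> [a b] /andP[_ /eqP /= ->].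
by apply: eq_bigl => y; rewrite !inE /= xP !eqxx !andbT andbC.
Qed.

Lemma pairs_between_sym P Q : symmetric h -> dd P Q = dd Q P.
Proof.
move=> hs; rewrite /pairs_between.
rewrite -(card_preimset (f := fun p : V * V => (p.2, p.1))); last first.
  by move=> [a b] [c d] [-> ->].
by apply: eq_card => [[a b]]; rewrite !inE /= (hs a b) [(a \in Q) && _]andbC.
Qed.

Lemma pairs_betweenT : dd setT setT = npairs h.
Proof. by apply: eq_card => p; rewrite !inE !andbT. Qed.

Lemma pairs_betweenUl P P' Q : [disjoint P & P'] ->
  dd (P :|: P') Q = dd P Q + dd P' Q.
Proof.
move=> d; rewrite !pairs_between_sum -bigU //.
by apply: eq_bigl => x; rewrite !inE.
Qed.

Lemma pairs_betweenUr P Q Q' : symmetric h -> [disjoint Q & Q'] ->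
  dd P (Q :|: Q') = dd P Q + dd P Q'.
Proof. by move=> hs d; rewrite !(pairs_between_sym P) // pairs_betweenUl. Qed.

Lemma pairs_between_square P Q : symmetric h -> [disjoint P & Q] ->
  dd (P :|: Q) (P :|: Q) = dd P P + 2 * dd P Q + dd Q Q.
Proof.
move=> hs d; rewrite pairs_betweenUl // !pairs_betweenUr // (pairs_between_sym Q P) //.
by lia.
Qed.

Lemma npairs_split P : symmetric h ->
  npairs h = dd P P + 2 * dd P (~: P) + dd (~: P) (~: P).
Proof.
move=> hs; rewrite -pairs_between_square ?setUCr ?pairs_betweenT //.
by rewrite -setI_eq0 setICr.
Qed.

Lemma pairs_between_le P Q : dd P Q <= #|P| * #|Q|.
Proof.
rewrite pairs_between_sum -sum_nat_const; apply: leq_sum => x _.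
by apply: subset_leq_card; apply/subsetP=> y; rewrite inE => /andP[].
Qed.

Lemma pairs_between_clique P : irreflexive h -> dd P P <= #|P| * #|P|.-1.
Proof.
move=> hi; rewrite pairs_between_sum -sum_nat_const; apply: leq_sum => x xP.
rewrite (cardsD1 x P) xP /= add0n; apply: subset_leq_card; apply/subsetP=> y.
by rewrite !inE => /andP[-> hxy]; rewrite andbT; apply: contraTneq hxy => ->;
  rewrite hi.
Qed.

Lemma pairs_between_gt0 P Q : 0 < dd P Q ->
  exists x y, [/\ h x y, x \in P & y \in Q].
Proof.
by case/card_gt0P=> [[x y]]; rewrite inE /= => /and3P[]; exists x, y.
Qed.

End PairsBetween.

(** Each vertex outside [W] is a component by itself, and [W] contributes at least one more. *)
Lemma n_comp_isolated (V : finType) (h : rel V) (W : {set V}) :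
  symmetric h -> (forall x y, h x y -> x \in W) -> 0 < #|W| ->
  #|V| + 1 <= n_comp h V + #|W|.
Proof.
move=> hs hW /card_gt0P[w wW].
have iso x y : x \notin W -> connect h x y -> y = x.
  move=> xW /connectP[[|z p] /=]; first by [].
  by case/andP=> /hW; rewrite (negPf xW).
have rW : root h w \in W.
  apply: contraLR wW => rW; suff -> : w = root h w by [].
  by apply: (iso _ _ rW); rewrite (sym_connect_sym hs) connect_root.
have : #|root h w |: ~: W| <= n_comp h V.
  apply: subset_leq_card; apply/subsetP=> x; rewrite !inE.
  rewrite andbT; case/orP=> [/eqP->|xW]; first exact/roots_root/sym_connect_sym.
  by apply/eqP/iso => //; apply: connect_root.
rewrite cardsU1 in_setC rW /=; have := cardsC W.
by move: #|W| #|~: W| #|V| (n_comp h V); lia.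
Qed.

Section EdgeBounds.

Variable T : plane_triangulation.
Local Notation D := (dart T).
Local Notation rev := (@Defs.rev T).
Local Notation phi := (face_step (@pt_rot T)).
Variable h : rel T.
Hypothesis h_sym : symmetric h.
Hypothesis h_adj : subrel h (@adj T).

(** Double counting: every dart along [h] lies in exactly one region. *)
Lemma region_size_bound m :
  (forall d0 : D, m <= #|[set d | connect (region h) d0 d
                                  && h (source d) (target d)]|) ->
  m * n_comp (region h) D <= npairs h.
Proof.
move=> hm; have cs := sym_connect_sym (region_sym h_sym).
have -> : npairs h = #|[set d : D | h (source d) (target d)]|.
  rewrite /npairs -(card_imset _ val_inj); apply: eq_card => [[x y]].
  rewrite inE /=; apply/idP/imsetP => [xy|[d]].
    have [d [sd td]] := dart_of (h_adj xy); exists d; first by rewrite inE sd td.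
    by rewrite -sd -td -surjective_pairing.
  by rewrite inE => hd dE; rewrite (congr1 fst dE : x = source d) (congr1 snd dE :
    y = target d).
rewrite -sum1_card (partition_big (root (region h)) (roots (region h))) /=; last first.
  by move=> d _; apply: roots_root.
rewrite mulnC /n_comp_mem -sum_nat_const.
rewrite (eq_bigl (roots (region h))); last by move=> d; rewrite !inE andbT.
apply: leq_sum => r rr; apply: leq_trans (hm r) _.
rewrite -sum1_card; apply: eq_leq; apply: eq_bigl => d; rewrite !inE andbC.
by rewrite -(root_connect cs) (eqP rr) eq_sym.
Qed.

Definition region_set (d0 : D) := [set d | connect (region h) d0 d].

Lemma sided_region d0 : #|[set d | sided (region_set d0)
  d]| <= 2 * #|[set d | connect (region h) d0 d
                                  && h (source d) (target d)]|.
Proof.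
have -> : [set d | sided (region_set d0) d] =
  [set d | xpredT d && sided (region_set d0) d] by [].
rewrite card_sided // leq_mul2l /=; apply: subset_leq_card; apply/subsetP=> d.
by rewrite !inE => /andP[-> /(region_sided h_sym)].
Qed.

(** A region without boundary is closed under [rev], hence is everything by [dart_set_full]. *)
Lemma region_all_or_sided d0 :
  region_set d0 = setT \/ exists d, sided (region_set d0) d.
Proof.
case: (pickP (sided (region_set d0))) => [d sd|ns]; [by right; exists d | left].
apply: (dart_set_full (d0 := d0)); rewrite ?inE ?connect0 //.
  exact: region_phi.
by move=> d; have := ns d; rewrite /sided => /negbFE/eqP.
Qed.

Lemma region_size_all d0 : region_set d0 = setT ->
  npairs h <= #|[set d | connect (region h) d0 d && h (source d) (target d)]|.
Proof.
move=> RT; rewrite /npairs -(card_imset _ (@val_inj _ _ (dart T))).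
apply: subset_leq_card; apply/subsetP=> [[x y]]; rewrite inE /= => xy.
have [d [sd td]] := dart_of (h_adj xy); apply/imsetP; exists d.
  have : d \in [set: D] by rewrite inE.
  by rewrite -RT !inE sd td => ->.
by rewrite -sd -td -surjective_pairing.
Qed.

Section Cycle.

Variable R : {set D}.
Hypothesis phiR : forall d, (phi d \in R) = (d \in R).
Let O := [set val d | d in [set d | sided R d]].

Lemma sided_pairs_sym x y : (x, y) \in O -> (y, x) \in O.
Proof.
case/imsetP=> d; rewrite inE => sd dE; apply/imsetP; exists (rev d).
  by rewrite inE sided_rev.
by rewrite /= -dE.
Qed.

Lemma sided_pairs_next x y : (x, y) \in O ->
  exists z, [/\ (y, z) \in O, z != x & z != y].
Proof.
move/sided_pairs_sym=> /imsetP[d]; rewrite inE => sd dE.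
have [e [se es et]] := sided_other phiR sd.
have sdy : source d = y by exact/esym/(congr1 fst dE).
have tdx : target d = x by exact/esym/(congr1 snd dE).
exists (target e); split; last 1 first.
- by apply: contraTneq (dart_adj e) => ->; rewrite es sdy adj_irrefl.
- apply/imsetP; exists e; first by rewrite inE.
  by rewrite -sdy -es -surjective_pairing.
- by rewrite -tdx.
Qed.

Lemma sided_pairs_neq x y : (x, y) \in O -> x != y.
Proof.
case/imsetP=> d _ dE; have := dart_adj d.
rewrite -(congr1 fst dE : x = source d) -(congr1 snd dE : y = target d).
by apply: contraTneq => ->; rewrite adj_irrefl.
Qed.

(** No vertex is an end of the boundary: a boundary edge [xy] continues at both ends, to [w] and
    [z], which gives three distinct edges even if [w = z]. *)
Lemma sided_size3 d : sided R d -> 6 <= #|[set d | sided R d]|.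
Proof.
move=> sd; rewrite -(card_imset _ (@val_inj _ _ (dart T))) -/O.
have : val d \in O by apply: imset_f; rewrite inE.
case: (val d) => x y xy.
have [w [yw wx wy]] := sided_pairs_next xy.
have [z [xz zy zx]] := sided_pairs_next (sided_pairs_sym xy).
pose s := [:: (x, y); (y, x); (x, z); (z, x); (y, w); (w, y)].
have ux : uniq s.
  have nxy := sided_pairs_neq xy.
  rewrite /s /= !inE !xpair_eqE !negb_or (negPf nxy) (eq_sym y x) (negPf nxy).
  rewrite (eq_sym x z) (eq_sym y z) (eq_sym x w) (eq_sym y w).
  by rewrite (negPf wx) (negPf wy) (negPf zx) (negPf zy) /= ?eqxx /= ?andbF.
have <- : #|s| = 6 := card_uniqP ux.
apply: subset_leq_card; apply/subsetP=> p.
by rewrite !inE => /or4P[/eqP->|/eqP->|/eqP->|/or3P[]/eqP->] //; apply: sided_pairs_sym.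
Qed.

(** The boundary is continued once more, from [z] to [t]. The bipartition excludes [w = z] and
    [t = y], so the four edges are distinct even if they close up to a 4-cycle. *)
Lemma sided_size4 (P : {set T}) d :
  (forall x y, (x, y) \in O -> (x \in P) != (y \in P)) ->
  sided R d -> 8 <= #|[set d | sided R d]|.
Proof.
move=> OP sd; rewrite -(card_imset _ (@val_inj _ _ (dart T))) -/O.
have : val d \in O by apply: imset_f; rewrite inE.
case: (val d) => x y xy.
have [w [yw wx wy]] := sided_pairs_next xy.
have [z [xz zy zx]] := sided_pairs_next (sided_pairs_sym xy).
have [t [zt tx tz]] := sided_pairs_next xz.
have neqP a b : (a \in P) != (b \in P) -> a != b.
  by apply: contraNneq => ->.
have [] := (OP _ _ xy, OP _ _ xz); have [] := (OP _ _ yw, OP _ _ zt) => p1 p2 p3 p4.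
have n1 : (w == z) = false.
  by apply/negbTE/neqP; move: p1 p2 p3 p4; do 5 case: (_ \in P).
have n2 : (t == y) = false.
  by apply/negbTE/neqP; move: p1 p2 p3 p4; do 5 case: (_ \in P).
pose s := [:: (x, y); (x, z); (w, y); (t, z); (y, x); (z, x); (y, w); (z, t)].
have ux : uniq s.
  have nxy := sided_pairs_neq xy.
  rewrite /s /= !inE !xpair_eqE !negb_or (negPf nxy) (eq_sym y x) (negPf nxy).
  rewrite (eq_sym x z) (eq_sym y z) (eq_sym x w) (eq_sym y w) (eq_sym x t)
    (eq_sym y t) (eq_sym z t) (eq_sym z w).
  by rewrite (negPf wx) (negPf wy) (negPf zx) (negPf zy) (negPf tx) (negPf tz)
    n1 n2 /= ?eqxx /= ?andbF.
have <- : #|s| = 8 := card_uniqP ux.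
apply: subset_leq_card; apply/subsetP=> p.
rewrite !inE => /or4P[/eqP->|/eqP->|/eqP->|]; rewrite ?(sided_pairs_sym yw) //.
by case/or4P=> [/eqP->|/eqP->|/eqP->|/orP[]/eqP->] //; apply: sided_pairs_sym.
Qed.

End Cycle.

Lemma region_size3 d0 : 3 < npairs h ->
  3 <= #|[set d | connect (region h) d0 d && h (source d) (target d)]|.
Proof.
move=> h4; pose R := region_set d0.
have phiR : forall d, (phi d \in R) = (d \in R) by exact: region_phi.
case: (region_all_or_sided d0) => [/region_size_all|[d sd]]; first by apply:
  leq_trans; lia.
have := sided_region d0; rewrite -/R; have := sided_size3 phiR sd; lia.
Qed.

Lemma region_size4 (P : {set T}) d0 : (forall x y, h x y -> (x \in P) != (y \in P)) ->
  3 < npairs h ->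
  4 <= #|[set d | connect (region h) d0 d && h (source d) (target d)]|.
Proof.
move=> hP h4; set R := region_set d0.
have phiR : forall d, (phi d \in R) = (d \in R) by exact: region_phi.
case: (region_all_or_sided d0) => [/region_size_all|[d sd]]; first by apply:
  leq_trans; lia.
have := sided_region d0; rewrite -/R.
suff : 8 <= #|[set d | sided R d]| by lia.
apply: (sided_size4 phiR (P := P)) sd.
move=> x y /imsetP[e]; rewrite inE => /(region_sided h_sym) he eE; apply: hP.
by rewrite (congr1 fst eE : x = source e) (congr1 snd eE : y = target e).
Qed.

(** Every region has at least three sides, which turns [euler_sub] into the bound [3n - 6]. The
    vertices outside [W] cancel against the components that they form. With at most three pairs the
    claim follows from the size of [W] alone. *)
Lemma edge_bound (W : {set T}) : (forall x y, h x y -> x \in W) -> 2 < #|W| ->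
  npairs h + 12 <= 6 * #|W|.
Proof.
move=> hW W3; case: (ltnP 3 (npairs h)) => [h4|]; last by lia.
have := region_size_bound (fun d => region_size3 d h4).
have := euler_sub h_sym h_adj; have := n_comp_isolated h_sym hW.
move: (npairs h) #|T| #|W| (n_comp h T) W3 (n_comp _ D) => a b c d; lia.
Qed.

Lemma bipartite_edge_bound (W P : {set T}) : (forall x y, h x y -> x \in W) ->
  (forall x y, h x y -> (x \in P) != (y \in P)) -> 2 < #|W| ->
  npairs h + 8 <= 4 * #|W|.
Proof.
move=> hW hP W3; case: (ltnP 3 (npairs h)) => [h4|]; last by lia.
have := region_size_bound (fun d => region_size4 d hP h4).
have := euler_sub h_sym h_adj; have := n_comp_isolated h_sym hW.
move: (npairs h) #|T| #|W| (n_comp h T) W3 (n_comp _ D) => a b c d; lia.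
Qed.

End EdgeBounds.

Section PlanarBounds.

Variable T : plane_triangulation.
Variable g : rel T.
Hypothesis g_sym : symmetric g.
Hypothesis g_adj : subrel g (@adj T).
Implicit Types P Q W : {set T}.

Lemma planar_bound W : 2 < #|W| -> pairs_between g W W + 12 <= 6 * #|W|.
Proof.
pose h : rel T := fun x y => [&& g x y, x \in W & y \in W].
apply: (edge_bound (h := h)) => [x y|x y /and3P[/g_adj]//|x y /and3P[]//].
by rewrite /h g_sym [(_ \in W) && _]andbC.
Qed.

Lemma planar_bipartite_bound P Q : [disjoint P & Q] -> 2 < #|P| + #|Q| ->
  pairs_between g P Q + 4 <= 2 * (#|P| + #|Q|).
Proof.
move=> dPQ PQ3; rewrite disjoint_sym in dPQ.
pose h : rel T := fun x y => g x y && ((x \in P) && (y \in Q) || (x \in Q) &&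
  (y \in P)).
have hE : npairs h = 2 * pairs_between g P Q.
  rewrite mul2n -addnn {2}pairs_between_sym // /npairs.
  rewrite (_ : [set _ | _] = [set p | [&& g p.1 p.2, p.1 \in P & p.2 \in Q]]
     :|: [set p | [&& g p.1 p.2, p.1 \in Q & p.2 \in P]]); last first.
    by apply/setP=> p; rewrite !inE -andb_orr.
  rewrite cardsU (_ : _ :&: _ = set0) ?cards0 ?subn0 //.
  apply/setP=> p; rewrite !inE; apply/negP => /andP[/and3P[_ pP _] /and3P[_ pQ _]].
  by rewrite (disjointFr dPQ pQ) in pP.
have cU : #|P :|: Q| = #|P| + #|Q|.
  by rewrite cardsU setIC (disjoint_setI0 dPQ) cards0 subn0.
suff : npairs h + 8 <= 4 * #|P :|: Q| by rewrite hE cU; lia.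
apply: (@bipartite_edge_bound _ h _ _ _ P); rewrite ?cU //.
- by move=> x y; rewrite /h g_sym orbC; congr (_ && (_ || _)); rewrite andbC.
- by move=> x y /andP[/g_adj].
- by move=> x y /andP[_ /orP[] /andP[xX _]]; rewrite inE xX ?orbT.
move=> x y /andP[_ /orP[] /andP[xX yX]].
  by rewrite xX (disjointFr dPQ yX).
by rewrite yX (disjointFr dPQ xX).
Qed.

End PlanarBounds.

Lemma npairs_triangulation (T : plane_triangulation) : npairs (@adj T) + 12 = 6 * #|T|.
Proof. by rewrite npairs_adj card_dart. Qed.

(** If every edge met [K], at most [3k - 6] edges would lie inside [K] and at most [2n - 4] would
    leave it, too few for the [3n - 6] edges of [T] when [3k < n + 4]. *)
Lemma edge_avoiding (T : plane_triangulation) (K : {set T}) :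
  3 * #|K| < #|T| + 4 -> 3 < #|T| ->
  exists x y : T, [/\ adj x y, x \notin K & y \notin K].
Proof.
move=> KT T3; case: (ltnP 0 (pairs_between (@adj T) (~: K) (~: K))) => [|le0].
  by case/pairs_between_gt0=> x [y]; rewrite !inE => -[]; exists x, y.
have nT := npairs_triangulation T; rewrite (npairs_split K (@adj_sym T)) in nT.
have cK := cardsC K.
have dK : [disjoint K & ~: K] by rewrite -setI_eq0 setICr.
have bK := planar_bipartite_bound (@adj_sym T) (fun x y xy => xy) dK.
(* The value 14 covers the sets of at most two vertices, which span at most two ordered pairs. *)
have qK : pairs_between (@adj T) K K + 12 <= maxn 14 (6 * #|K|).
  case: (ltnP 2 #|K|) => K3.
    by have := planar_bound (@adj_sym T) (fun x y xy => xy) K3; lia.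
  have := pairs_between_clique K (@adj_irrefl T).
  by case: #|K| K3 => [|[|[|]]] //; lia.
move: nT le0 bK qK cK KT T3.
move: (pairs_between (@adj T) K K) (pairs_between (@adj T) K (~: K)).
move: (pairs_between (@adj T) (~: K) (~: K)).
move: #|K| #|~: K| #|T| => *; lia.
Qed.

(** * Separating vertex sets *)

Section Separator.

Variable T : plane_triangulation.
Local Notation D := (dart T).
Local Notation rev := (@Defs.rev T).
Local Notation phi := (face_step (@pt_rot T)).
Variables (g : rel T) (S : {set T}).
Hypothesis g_sym : symmetric g.
Hypothesis g_adj : subrel g (@adj T).

(* [A] contains at most one dart of each face, and [B] is a union of faces. *)
Lemma card_face_transversal (A B : {set D}) :
  (forall d, d \in A -> phi d \notin A) -> A \subset B ->
  (forall d, d \in B -> phi d \in B) -> 3 * #|A| <= #|B|.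
Proof.
move=> phiA AB phiB.
pose A1 := phi @: A; pose A2 := phi @: A1.
have A1B : A1 \subset B.
  by apply/subsetP=> _ /imsetP[d dA ->]; apply/phiB/(subsetP AB).
have A2B : A2 \subset B.
  by apply/subsetP=> _ /imsetP[d dA ->]; apply/phiB/(subsetP A1B).
have c1 : #|A1| = #|A| by rewrite card_imset //; apply: phi_inj.
have c2 : #|A2| = #|A| by rewrite card_imset //; apply: phi_inj.
have d1 : A :&: A1 = set0.
  apply/setP=> d; rewrite !inE; apply/andP=> -[dA /imsetP[e eA dE]].
  by have := phiA _ eA; rewrite -dE dA.
have d2 : A1 :&: A2 = set0.
  rewrite /A2 {1}/A1 -imsetI ?d1 ?imset0 //; first by move=> ? ? _ _; apply: phi_inj.
have d3 : A :&: A2 = set0.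
  apply/setP=> d; rewrite !inE; apply/andP=> -[dA /imsetP[e /imsetP[f fA eE] dE]].
  by have := phiA _ dA; rewrite dE eE phi3 fA.
have : #|(A :|: A1) :|: A2| <= #|B|.
  by apply: subset_leq_card; rewrite !subUset AB A1B.
rewrite !cardsU d1 setIUl d2 d3 setU0 cards0 c1 c2 => /leP; move: #|A| #|B| => *; lia.
Qed.

Definition inner_edges : rel T := fun x y => [&& g x y, x \notin S & y \notin S].
Local Notation h := inner_edges.

Lemma inner_edges_sym : symmetric h.
Proof. by move=> x y; rewrite /h g_sym [_ && (_ \notin S)]andbC. Qed.

Lemma inner_edges_adj : subrel h (@adj T).
Proof. by move=> x y /andP[/g_adj]. Qed.

Lemma npairs_inner_edges : npairs h = pairs_between g (~: S) (~: S).
Proof. by apply: eq_card => p; rewrite !inE. Qed.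

(** The regions of [G - S] that contain a face of [T] with a corner in [S], each given by its
    root. *)
Definition outer_regions := [set root (region h) d | d in [set d : D | source d \in S]].

(** The darts of the faces of [T] that have no corner in [S]. *)
Let sfree := [set d : D | [&& source d \notin S, source (phi d) \notin S
                            & source (phi (phi d)) \notin S]].

Lemma sfree_phi d : (phi d \in sfree) = (d \in sfree).
Proof. by rewrite !inE phi3; do 3!case: (_ \in S). Qed.

(** Going around a triangle, one leaves [S] at most once, so the darts leaving [S] lie in distinct
    faces, all of which meet [S]. *)
Lemma pairs_between_sfree :
  3 * pairs_between g S (~: S) + #|sfree| <= #|D|.
Proof.
pose A := [set d : D | (source d \in S) && (target d \notin S)].
have -> : #|D| = #|~: sfree| + #|sfree| by rewrite -(cardsC sfree) addnC.
rewrite leq_add2r; apply: leq_trans (_ : 3 * #|A| <= _).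
  rewrite leq_mul2l /= -(card_imset (mem A) (@val_inj _ _ (dart T))).
  apply: subset_leq_card; apply/subsetP=> [[x y]]; rewrite !inE /= => /and3P[xy xS yS].
  have [d [sd td]] := dart_of (g_adj xy); apply/imsetP; exists d.
    by rewrite !inE sd td xS.
  by rewrite -sd -td -surjective_pairing.
apply: card_face_transversal => [d|| d].
- by rewrite !inE source_phi => /andP[_ /negPf->].
- by apply/subsetP=> d; rewrite !inE => /andP[-> _].
by rewrite !in_setC sfree_phi.
Qed.

(* A region outside [outer_regions] contains a whole face avoiding [S]. *)
Lemma region_sfree :
  3 * n_comp (region h) D <= #|sfree| + 3 * #|outer_regions|.
Proof.
have rs := region_sym inner_edges_sym; have cs := sym_connect_sym rs.
pose A := [set r : D | roots (region h) r] :\: outer_regions.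
have phir d : root (region h) (phi d) = root (region h) d.
  by apply/eqP; rewrite root_connect // cs connect1 // /region eqxx.
have nsource d : root (region h) d \notin outer_regions -> source d \notin S.
  by apply: contraNN => dS; apply: imset_f; rewrite inE.
have : 3 * #|A| <= #|sfree|.
  apply: card_face_transversal => [d||d]; last by rewrite sfree_phi.
  - rewrite !inE => /andP[_ /eqP rd]; rewrite negb_and negbK; apply/orP; right.
    apply/eqP; rewrite phir rd => E.
    by have := dart_adj d; rewrite -source_phi -E adj_irrefl.
  apply/subsetP=> d; rewrite !inE => /andP[dO /eqP rd].
  by rewrite !nsource ?phir ?rd.
have : n_comp (region h) D <= #|A| + #|outer_regions|.
  rewrite addnC -[X in _ <= _ + X]addn0 /n_comp_mem.
  have -> : #|predI (roots (region h)) (mem D)| = #|[set r : D | roots (region h) r]|.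
    by rewrite cardsE; apply: eq_card => r; rewrite !inE andbT.
  rewrite addn0 addnC -(cardsID outer_regions) addnC leq_add2l.
  by apply/subset_leq_card/subsetIr.
move: #|A| (n_comp (region h) D) #|outer_regions| #|sfree| => *; lia.
Qed.

(** Euler's formula bounds the edges of [G - S] by its regions. A region is outer or contains a face
    avoiding [S], and such faces are rare, as each edge leaving [S] takes up a face that meets
    [S]. *)
Lemma separator_bound :
  2 * pairs_between g S (~: S) + pairs_between g (~: S) (~: S)
    + 2 * n_comp h T + 10 <= 6 * #|T| + 2 * #|outer_regions|.
Proof.
have := euler_sub inner_edges_sym inner_edges_adj.
have := region_sfree; have := pairs_between_sfree; have := card_dart T.
rewrite npairs_inner_edges.
move: #|sfree| #|outer_regions| (n_comp h T) (n_comp (region h) D) #|T| #|D|.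
move: (pairs_between g S (~: S)) (pairs_between g (~: S) (~: S)).
move=> *; lia.
Qed.

(** No edge at a vertex of [S] is an inner edge, so all faces around that vertex are glued
    together. *)
Lemma outer_region_vertex d d' :
  source d \in S -> source d = source d' -> root (region h) d = root (region h) d'.
Proof.
move=> dS ss; have cs := sym_connect_sym (region_sym inner_edges_sym).
have rotr e : source e \in S -> connect (region h) e (pt_rot T e).
  move=> eS; apply: (@connect_trans _ _ (rev e)).
    by apply: connect1; rewrite /region eqxx /inner_edges eS andbF !orbT.
  by apply: connect1; rewrite -phi_rev /region eqxx.
have : fconnect (pt_rot T) d d' by rewrite pt_rotation ss.
case/iter_findex; move: (findex _ _ _) => i <-; apply/eqP; rewrite root_connect //.
elim: i => [|i IH] /=; first exact: connect0.
apply: connect_trans IH (rotr _ _).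
by elim: i => //= i; rewrite source_rot.
Qed.

Lemma outer_region_adj d : source d \in S -> root (region h) d = root (region h)
  (rev d).
Proof.
move=> dS; apply/eqP; rewrite root_connect;
  last exact/sym_connect_sym/region_sym/inner_edges_sym.
by apply: connect1; rewrite /region eqxx /inner_edges dS andbF !orbT.
Qed.

Lemma card_outer_regions : #|outer_regions| <= #|S|.
Proof.
pose R (r : D) := odflt r [pick d | (source d \in S) && (root (region h) d == r)].
have RP r : r \in outer_regions -> (source (R r) \in S) && (root (region h) (R r) == r).
  case/imsetP=> d; rewrite inE => dS ->; rewrite /R; case: pickP => //= /(_ d).
  by rewrite dS eqxx.
rewrite -(card_in_imset (f := fun r => source (R r))); last first.
  move=> r r' /RP/andP[rS /eqP rE] /RP/andP[rS' /eqP rE'] E.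
  by rewrite -rE -rE'; apply: outer_region_vertex.
by apply/subset_leq_card/subsetP=> _ /imsetP[r /RP/andP[rS _] ->].
Qed.

(** Adjacent vertices of [S] lie in the same outer region. Hence the vertices of [S] in one of
    several outer regions have no neighbour in the rest of [S]. *)
Lemma outer_regions_split : 1 < #|outer_regions| ->
  exists P : {set T}, [/\ P \subset S, P != set0, P != S &
    forall x y, x \in P -> y \in S -> y \notin P -> ~~ g x y].
Proof.
case/card_gt1P=> _ [_ [/imsetP[d dS ->] /imsetP[e eS ->] de]].
rewrite !inE in dS eS.
pose P := [set x in S | [exists f : D, (source f == x) && (root (region h)
  f == root (region h) d)]].
have inP f : source f \in S -> (source f \in P) = (root (region h)
  f == root (region h) d).
  move=> fS; rewrite inE fS /=; apply/existsP/idP => [[f' /andP[/eqP ff' /eqP<-]]|fd].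
    by apply/eqP/outer_region_vertex.
  by exists f; rewrite eqxx.
exists P; split.
- by apply/subsetP=> x; rewrite inE => /andP[].
- by apply/set0Pn; exists (source d); rewrite inP.
- by apply: contraNneq de => PS; rewrite eq_sym -inP // PS.
move=> x y xP yS; apply: contraNN => xy.
have [f [fx fy]] := dart_of (g_adj xy).
have xS : x \in S by move: xP; rewrite inE => /andP[].
rewrite -fx inP ?fx // in xP; rewrite -fy -source_rev inP ?source_rev ?fy //.
by rewrite -outer_region_adj ?fx.
Qed.

End Separator.

(** * Maximum matchings *)

Section Alternating.

Variables (V : finType) (M N : V -> V) (t : V).
Hypotheses (MK : involutive M) (NK : involutive N) (Nt : N t = t).
Let p := N \o M.
Let p_inj : injective p := inj_comp (inv_inj NK) (inv_inj MK).
Let X := [set x | fconnect p t x].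

(** The map [p] advances two steps along the alternating path that starts at [t]. As [t] is an end
    of the path, the orbit of [p] runs along it and back, and so contains all of it. *)
Lemma alternatingN x : x \in X -> N x \in X.
Proof.
rewrite inE => /iter_findex <-; elim: (findex p t x) => [|i IH].
  by rewrite /= Nt inE connect0.
rewrite /= /p /= NK inE (same_connect_r (fconnect_sym p_inj) (y := N (iter i p t))).
  by rewrite inE in IH.
by apply: connect1; rewrite /= /p /= MK.
Qed.

Lemma alternatingM x : x \in X -> M x \in X.
Proof.
move/alternatingN; rewrite !inE => c; apply: connect_trans c _.
by rewrite fconnect_sym //; apply: connect1; rewrite /= /p /= MK.
Qed.

Lemma alternating_order k : iter k p t = t -> 0 < k < 2 * order p t -> k = order p t.
Proof.
have small j : iter j p t = t -> j < order p t -> j = 0.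
  move=> jt jo; apply/eqP; rewrite -(nth_uniq t _ _ (orbit_uniq p t))
    ?size_orbit ?order_gt0 //.
  by rewrite /orbit !nth_traject ?order_gt0 //= jt.
move=> kt /andP[k0 k2]; case: (ltnP k (order p t)) => ko.
  by move: k0; rewrite (small k kt ko).
have E : iter (k - order p t) p t = t.
  by rewrite -[RHS]kt -{2}(subnK ko) iterD iter_order.
by have := small _ E; lia.
Qed.

(** At a vertex fixed by [M] the walk turns back, and it is at [t] again after [2i + 1] steps, where
    [i] is the index of that vertex. This number is the length of the orbit, which therefore
    determines [i]. *)
Lemma alternating_fixed x y : x \in X -> y \in X -> M x = x -> M y = y -> x = y.
Proof.
have iterN i : iter i p (N (iter i p t)) = t.
  by elim: i => [|i IH] //; rewrite iterSr /= {2}/p /= NK {2}/p /= MK.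
have odd_order z : z \in X -> M z = z -> (findex p t z).*2.+1 = order p t.
  rewrite inE => tz Mz; have zE := iter_findex tz; have := findex_max tz.
  move: (findex p t z) zE => i zE io; apply: alternating_order; last by lia.
  rewrite -addnn -addnS iterD iterS zE {2}/p /= Mz -{1}zE; exact: iterN.
move=> xX yX /(odd_order _ xX) ox /(odd_order _ yX) oy; rewrite !inE in xX yX.
by rewrite -(iter_findex xX) -(iter_findex yX); congr (iter _ _ _); lia.
Qed.

End Alternating.

Section Gallai.

Variables (V : finType) (g : rel V).
Hypotheses (g_sym : symmetric g) (g_irr : irreflexive g).
Implicit Types (U S : {set V}) (f m M N : {ffun V -> V}).

Definition moved f := [set x | f x != x].

(** A matching is an involution that exchanges the ends of its edges and fixes the uncovered
    vertices; [moved f] then has two elements for each edge. *)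
Definition is_matching U f :=
  [forall x, (f (f x) == x) && ((f x == x) || [&& g x (f x), x \in U & f x \in U])].

Lemma matchingK U f : is_matching U f -> involutive f.
Proof. by move=> /forallP fm x; have /andP[/eqP] := fm x. Qed.

Lemma matching_edge U f x : is_matching U f -> f x != x ->
  [&& g x (f x), x \in U & f x \in U].
Proof. by move=> /forallP/(_ x)/andP[_ /orP[->|]]. Qed.

Lemma is_matchingI U f : involutive f ->
  (forall x, f x != x -> [&& g x (f x), x \in U & f x \in U]) -> is_matching U f.
Proof.
by move=> fK fe; apply/forallP=> x; rewrite fK eqxx /=; case: eqP => //= /eqP/fe.
Qed.

Lemma sub_matching U U' f : U \subset U' -> is_matching U f -> is_matching U' f.
Proof.
move=> /subsetP UU fm; apply: is_matchingI; first exact: matchingK fm.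
by move=> x /(matching_edge fm)/and3P[-> /UU-> /UU->].
Qed.

Definition matching_half f := [set x | enum_rank x < enum_rank (f x)].

Lemma card_moved f : involutive f -> #|moved f| = 2 * #|matching_half f|.
Proof.
move=> fK; have -> : moved f = matching_half f :|: f @: matching_half f.
  apply/setP=> x; rewrite !inE; apply/idP/orP.
    move=> fx; have : (enum_rank (f x) : nat) != enum_rank x.
      by rewrite (inj_eq val_inj) (inj_eq enum_rank_inj).
    rewrite neq_ltn => /orP[lt|lt]; [right|left] => //.
    by apply/imsetP; exists (f x); rewrite ?fK // inE fK.
  case=> [lt|/imsetP[y]]; first by apply: contraTneq lt => ->; rewrite ltnn.
  by rewrite inE => lt ->; rewrite fK; apply: contraTneq lt => <-; rewrite ltnn.
rewrite cardsU (_ : _ :&: _ = set0); last first.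
  apply/setP=> x; rewrite !inE; apply/andP=> -[lt /imsetP[y]]; rewrite inE => lt' xE.
  by move: lt; rewrite xE fK; lia.
by rewrite cards0 subn0 card_imset ?mul2n ?addnn //; apply: inv_inj.
Qed.

Definition max_matching U f := is_matching U f /\
  forall f', is_matching U f' -> #|moved f'| <= #|moved f|.

Lemma max_matching_exists U : exists f, max_matching U f.
Proof.
have m0 : is_matching U [ffun x => x].
  by apply: is_matchingI => x; rewrite !ffunE ?eqxx.
have [f fm fmax] := arg_maxnP (fun f => #|moved f|) m0.
by exists f.
Qed.

Lemma max_matching_adj U M u v : max_matching U M -> u \in U -> v \in U -> g u v ->
  M u = u -> M v = v -> False.
Proof.
case=> Mm Mmax uU vU uv Mu Mv; have MK := matchingK Mm.
have nuv : v != u by apply: contraTneq uv => ->; rewrite g_irr.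
have nuv' : (u == v) = false by rewrite eq_sym (negPf nuv).
pose f := [ffun x => if x == u then v else if x == v then u else M x].
have fK : involutive f.
  move=> x; rewrite !ffunE; case: (altP (x =P u)) => [->|xu];
    first by rewrite (negPf nuv) eqxx.
  case: (altP (x =P v)) => [->|xv]; first by rewrite eqxx.
  have -> : (M x == u) = false by rewrite -[u]Mu (inj_eq (inv_inj MK)) (negPf xu).
  have -> : (M x == v) = false by rewrite -[v]Mv (inj_eq (inv_inj MK)) (negPf xv).
  exact: MK.
have fm : is_matching U f.
  apply: is_matchingI => // x; rewrite !ffunE.
  case: (altP (x =P u)) => [->|xu]; first by rewrite uv uU vU.
  case: (altP (x =P v)) => [->|xv]; first by rewrite g_sym uv uU vU.
  exact: matching_edge Mm.
have := Mmax f fm; suff -> : moved f = u |: (v |: moved M).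
  by rewrite !cardsU1 !inE nuv' Mu Mv !eqxx /=; lia.
apply/setP=> x; rewrite !inE !ffunE.
case: (altP (x =P u)) => [->|xu]; first by rewrite nuv.
by case: (altP (x =P v)) => [->|xv] //=; rewrite nuv'.
Qed.

(* Exchange [M] and [N] along the alternating path that starts at [t]: the path
   has at most one end left uncovered by [M], hence avoids [u] or [v]. *)
Lemma max_matching_switch U M N u v t : max_matching U M -> max_matching U N ->
  u != v -> M u = u -> M v = v -> N t = t ->
  exists2 f, max_matching U f & f t = t /\ (f u = u \/ f v = v).
Proof.
case=> Mm Mmax [Nm Nmax] uv Mu Mv Nt.
have MK := matchingK Mm; have NK := matchingK Nm.
pose X := [set x | fconnect (N \o M) t x].
have XN x : (N x \in X) = (x \in X).
  by apply/idP/idP=> /(alternatingN MK NK Nt); rewrite ?NK.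
have XM x : (M x \in X) = (x \in X).
  by apply/idP/idP=> /(alternatingM MK NK Nt); rewrite ?MK.
have tX : t \in X by rewrite inE connect0.
have Xuv : u \in X -> v \in X -> u = v.
  by move=> uX vX; apply: (alternating_fixed MK NK Nt uX vX).
clearbody X.
pose sw (A B : {ffun V -> V}) : {ffun V -> V} := [ffun x =>
  if x \in X then A x else B x].
have swm A B : is_matching U A -> is_matching U B ->
  (forall x, (A x \in X) = (x \in X)) -> (forall x, (B x \in X) = (x \in X)) ->
  is_matching U (sw A B).
  move=> Am Bm XA XB; apply: is_matchingI => x; rewrite !ffunE.
    case: (boolP (x \in X)) => xX; rewrite ?XA ?XB ?xX ?(negPf xX).
      exact: (matchingK Am).
    exact: (matchingK Bm).
  by case: ifP => _; [apply: matching_edge Am | apply: matching_edge Bm].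
have swc A B : #|moved (sw A B)| = #|moved A :&: X| + #|moved B :\: X|.
  rewrite -(cardsID X (moved (sw A B))).
  by congr (_ + _); apply: eq_card => x; rewrite !inE !ffunE; case:
    (boolP (x \in X)); rewrite ?andbF ?andbT.
have NMm := swm _ _ Nm Mm XN XM; have MNm := swm _ _ Mm Nm XM XN.
exists (sw N M).
  split=> // f /Mmax fM; apply: leq_trans fM _.
  (* The opposite exchange [sw M N] is no larger than [N], so [N] covers at least as much of [X] as
     [M] does. *)
  have := Nmax _ MNm; rewrite !swc -(cardsID X (moved N)) -(cardsID X (moved M)).
  by rewrite leq_add2r => le; rewrite leq_add2r.
split; first by rewrite ffunE tX.
case: (boolP (u \in X)) => uX; last by left; rewrite ffunE (negPf uX).
by right; rewrite ffunE; case: ifP => // vX; case/eqP: uv; apply: Xuv.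
Qed.

Definition restrict U : rel V := fun x y => [&& g x y, x \in U & y \in U].

(** Gallai's lemma, by induction on a path from [u] to [v] with second vertex [w]. Switching with a
    maximum matching that misses [w] gives one that misses [w] and [u], which could be enlarged by
    the edge [uw], or [w] and [v], which are joined by a shorter path. *)
Lemma gallai U : (forall v, v \in U -> exists2 f, max_matching U f & f v = v) ->
  forall M u v, max_matching U M -> connect (restrict U) u v ->
  M u = u -> M v = v -> u = v.
Proof.
move=> missed M u v Mmax /connectP[p]; elim: p M u Mmax => [|w p IH] M u Mmax /=.
  by move=> _ ->.
case/andP=> /and3P[uw uU wU] pw vE Mu Mv; apply/eqP/negPn/negP => uv.
case: (altP (w =P v)) => [wv|wv].
  by subst v; rewrite wv in uw wU; apply: (max_matching_adj Mmax uU wU uw Mu Mv).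
have [N Nmax Nw] := missed w wU.
have [f fmax [fw]] := max_matching_switch Mmax Nmax uv Mu Mv Nw.
case=> [fu|fv]; first exact: (max_matching_adj fmax uU wU uw fu fw).
by case/eqP: wv; apply: (IH f).
Qed.

(** Vertices covered by all maximum matchings are moved into [S] one at a time, each lowering the
    matching number. Once none is left, Gallai's lemma applies to the remaining graph. *)
Lemma gallai_edmonds_sub U : exists S m,
  [/\ S \subset U, is_matching (U :\: S) m,
      forall x y, m x = x -> m y = y -> connect (restrict (U :\: S)) x y -> x = y &
      exists2 m', is_matching U m' & 2 * #|S| + #|moved m| <= #|moved m'|].
Proof.
move: {2}(#|U|) (leqnn #|U|) => k; elim: k U => [|k IH] U.
  rewrite leqn0 cards_eq0 => /eqP->; exists set0, [ffun x => x]; split;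
    first exact: sub0set.
  - by apply: is_matchingI => x; rewrite !ffunE ?eqxx.
  - move=> x y _ _ /connectP[[|z p]] /=; first by [].
    by rewrite /restrict !inE /= !andbF.
  exists [ffun x => x]; first by apply: is_matchingI => x; rewrite !ffunE ?eqxx.
  by rewrite cards0.
move=> Uk; case: (boolP [forall v in U, exists f : {ffun V -> V},
   [&& is_matching U f, [forall f' : {ffun V -> V}, is_matching U f' ==>
     (#|moved f'| <= #|moved f|)]
     & f v == v]]) => [/forall_inP missed|].
  have [M Mmax] := max_matching_exists U.
  exists set0, M; rewrite setD0 cards0; split; first exact: sub0set.
  - by case: Mmax.
  - move=> x y Mx My c; apply: gallai c Mx My => // v /missed/existsP[f].
    case/and3P=> fm /forallP fmax /eqP fv; exists f => //; split=> // f' f'm.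
    by have := fmax f'; rewrite f'm.
  by exists M; rewrite ?muln0; case: Mmax.
case/forall_inPn=> v vU /existsPn hv.
have [|S [m [SU mm mc [m' m'm le]]]] := IH (U :\ v).
  by move: Uk; rewrite (cardsD1 v U) vU; lia.
have UE : U :\: (v |: S) = U :\ v :\: S by rewrite setDDl.
have vS : v \notin S by apply/negP=> /(subsetP SU); rewrite !inE eqxx.
exists (v |: S), m; rewrite UE; split=> //.
  by apply/subsetP=> x; rewrite !inE => /orP[/eqP->//|/(subsetP SU)];
    rewrite !inE => /andP[].
have [N [Nm Nmax]] := max_matching_exists U.
exists N => //; rewrite cardsU1 vS.
have m'U : is_matching U m' := sub_matching (subD1set U v) m'm.
have m'v : m' v = v.
  by apply/eqP/negPn/negP => /(matching_edge m'm)/and3P[_]; rewrite !inE eqxx.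
(* By the choice of [v], a matching that misses [v] is not maximum. *)
have : #|moved m'| < #|moved N|.
  rewrite ltnNge; apply: contra (hv m') => Nm'; rewrite m'U m'v eqxx andbT.
  by apply/forallP=> f; apply/implyP=> /Nmax fN; apply: leq_trans fN Nm'.
move: le; rewrite (card_moved (matchingK m'm)) (card_moved (matchingK Nm)); lia.
Qed.

Lemma gallai_edmonds : exists S m,
  [/\ is_matching (~: S) m,
      forall x y, m x = x -> m y = y -> connect (restrict (~: S)) x y -> x = y &
      exists2 m', is_matching setT m' & 2 * #|S| + #|moved m| <= #|moved m'|].
Proof.
have [S [m]] := gallai_edmonds_sub setT; rewrite setTD => -[_ mm mc ex].
by exists S, m.
Qed.

End Gallai.

(** * Systems of distinct representatives *)

Section Surplus.

Variables (V W : finType) (L : {set V}) (s : nat).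
Implicit Types (N : V -> {set W}) (A : {set V}).

(** Hall's condition with an excess of [s], for nonempty subsets of [L]. *)
Definition surplus N :=
  forall A, A \subset L -> A != set0 -> #|A| + s <= #|\bigcup_(a in A) N a|.

Definition remove N a p : V -> {set W} := fun x => if x == a then N x :\ p else N x.

(* Removing either of two elements of a large [N a] cannot spoil the surplus
   both times: the two violating sets contain [a], and submodularity yields a
   contradiction from their union and intersection. *)
Lemma surplus_remove N a p q : surplus N -> a \in L -> p \in N a -> q \in N a ->
  p != q -> s.+1 < #|N a| -> surplus (remove N a p) \/ surplus (remove N a q).
Proof.
move=> hN aL pN qN pq Na.
have viol r : surplus (remove N a r) \/ exists A, [/\ A \subset L, a \in A &
    #|\bigcup_(x in A) remove N a r x| < #|A| + s].
  case: (boolP [exists A : {set V}, [&& A \subset L, A != set0 &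
      #|\bigcup_(x in A) remove N a r x| < #|A| + s]]) => [/existsP[A]|/existsPn no].
    case/and3P=> AL A0 lt; right; exists A; split=> //.
    apply: contraLR lt => aA; rewrite -leqNgt.
    rewrite (eq_bigr N); first exact: hN.
    by move=> x xA; rewrite /remove; case: eqP => // xa; rewrite -xa xA in aA.
  by left=> A AL A0; have := no A; rewrite AL A0 /= -leqNgt.
have [|[A [AL aA ltA]]] := viol p; first by left.
have [|[B [BL aB ltB]]] := viol q; first by right.
set X := \bigcup_(x in A) _ in ltA; set Y := \bigcup_(x in B) _ in ltB.
have XN x b : b \in A -> b != a -> x \in N b -> x \in X.
  by move=> bA ba xb; apply/bigcupP; exists b => //; rewrite /remove (negPf ba).
have YN x b : b \in B -> b != a -> x \in N b -> x \in Y.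
  by move=> bA ba xb; apply/bigcupP; exists b => //; rewrite /remove (negPf ba).
have Xa x : x != p -> x \in N a -> x \in X.
  by move=> xp xN; apply/bigcupP; exists a => //; rewrite /remove eqxx !inE xp.
have Ya x : x != q -> x \in N a -> x \in Y.
  by move=> xp xN; apply/bigcupP; exists a => //; rewrite /remove eqxx !inE xp.
have hU : #|A :|: B| + s <= #|X :|: Y|.
  apply: leq_trans (hN (A :|: B) _ _) _.
  - by rewrite subUset AL BL.
  - by apply/set0Pn; exists a; rewrite inE aA.
  apply/subset_leq_card/subsetP=> x /bigcupP[b]; rewrite !inE.
  case: (altP (b =P a)) => [->|ba] bAB xb.
    by case: (altP (x =P p)) => [->|xp]; [rewrite Ya ?orbT | rewrite Xa].
  by case/orP: bAB => [bA|bB]; [rewrite (XN x b) | rewrite (YN x b) ?orbT].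
have hI : #|A :&: B| + s <= #|X :&: Y| + 1.
  rewrite (cardsD1 a (A :&: B)) inE aA aB /=.
  suff : #|(A :&: B) :\ a| + s <= #|X :&: Y| by lia.
  case: (set_0Vmem ((A :&: B) :\ a)) => [->|[b bAB]].
    rewrite cards0 add0n; apply: leq_trans (_ : #|N a :\ p :\ q| <= _).
      move: Na; rewrite (cardsD1 p) pN (cardsD1 q (N a :\ p)) !inE qN eq_sym pq; lia.
    apply/subset_leq_card/subsetP=> x; rewrite !inE => /and3P[xq xp xN].
    by rewrite Xa ?Ya.
  apply: leq_trans (hN _ _ _) _.
  - by apply/subsetP=> x; rewrite !inE => /and3P[_ /(subsetP AL)].
  - by apply/set0Pn; exists b.
  apply/subset_leq_card/subsetP=> x /bigcupP[c]; rewrite !inE => /and3P[ca cA cB] xc.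
  by rewrite (XN x c) ?(YN x c).
have := cardsUI A B; have := cardsUI X Y; lia.
Qed.

(** As long as some set has more than [s + 1] elements, [surplus_remove] deletes one of them; the
    total size decreases. *)
Lemma surplus_thin N : surplus N -> exists N',
  [/\ surplus N', forall a, N' a \subset N a & forall a, a \in L -> #|N' a| <= s.+1].
Proof.
move: {2}(\sum_(a in L) _) (leqnn (\sum_(a in L) #|N a|)) => k.
elim: k N => [|k IH] N le hN.
  exists N; split=> // a aL; apply: leq_trans (_ : 0 <= _) => //.
  by apply: leq_trans le; rewrite (bigD1 a) //= leq_addr.
case: (boolP [forall a in L, #|N a| <= s.+1]) => [/forall_inP small|].
  by exists N.
case/forall_inPn=> a aL; rewrite -ltnNge => Na.
have /card_gt1P[p [q [pN qN pq]]] : 1 < #|N a| by apply: leq_ltn_trans Na.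
suff key r : r \in N a -> surplus (remove N a r) -> exists N',
  [/\ surplus N', forall a, N' a \subset N a & forall a, a \in L -> #|N' a| <= s.+1].
  by case: (surplus_remove hN aL pN qN pq Na); apply: key.
move=> rN /IH[|N' [sN' subN' cN']].
  rewrite -ltnS; apply: leq_trans le; rewrite (bigD1 a) //= [ltnRHS](bigD1 a) //=.
  rewrite {1}/remove eqxx [X in _ < X + _](cardsD1 r) rN /= add1n addSn ltnS leq_add2l.
  by apply: leq_sum => b /andP[_ ba]; rewrite /remove (negPf ba).
exists N'; split=> // b; apply: subset_trans (subN' b) _.
by rewrite /remove; case: ifP => // _; apply: subsetDl.
Qed.

End Surplus.

(** Thinning with surplus 0 reduces the sets to singletons, which are distinct by the condition on
    pairs. *)
Lemma hall (V W : finType) (w0 : W) (L : {set V}) (N : V -> {set W}) :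
  (forall A : {set V}, A \subset L -> #|A| <= #|\bigcup_(a in A) N a|) ->
  exists f : V -> W, {in L &, injective f} /\ {in L, forall a, f a \in N a}.
Proof.
move=> hN; have sN : surplus L 0 N by move=> A AL _; rewrite addn0; apply: hN.
have [N' [sN' subN' cN']] := surplus_thin sN.
have N'1 a : a \in L -> exists w, N' a = [set w].
  move=> aL; apply/cards1P; rewrite eqn_leq cN' //=.
  have := sN' [set a]; rewrite big_set1 cards1 addn0 sub1set; apply=> //.
  by apply/set0Pn; exists a; rewrite inE.
pose f a := odflt w0 [pick w in N' a].
have fN a : a \in L -> N' a = [set f a].
  by move=> aL; have [w E] := N'1 a aL; rewrite /f E; case: pickP => [x|/(_ w)];
    rewrite inE ?eqxx // => /eqP->.
exists f; split=> [a b aL bL fab|a aL]; last by apply: (subsetP (subN' a));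
  rewrite fN // inE.
apply/eqP/negPn/negP => ab; have := sN' [set a; b].
rewrite subUset !sub1set aL bL bigcup_setU !big_set1 !fN // fab setUid cards1 cards2 ab.
suff -> : [set a; b] != set0 by move/(_ isT isT).
by apply/set0Pn; exists a; rewrite !inE eqxx.
Qed.

(** * Matchings that survive the loss of an edge *)

Section RobustMatching.

Variable T : plane_triangulation.
Variables (g : rel T) (S E : {set T}).
Hypothesis T30 : 30 <= #|T|.
Hypothesis g_sym : symmetric g.
Hypothesis g_adj : subrel g (@adj T).
Hypothesis g_big : 4 * #|T| + 8 <= npairs g.
Let W := S :|: E.
Hypothesis g_out : forall x y, g x y -> x \notin W -> y \in S.
Hypothesis S4 : 4 <= #|S|.
Hypothesis W15 : #|W| + 2 * #|S| <= 15.
Hypothesis g_local : forall v, v \in S ->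
  pairs_between g W W + 18 <= 6 * #|W| + 2 * pairs_between g [set v] (S :\ v).
Local Notation dd := (pairs_between g).
Let nbr a := [set i in ~: W | g a i].
(** The vertices of [S] with few outer neighbours. Eight neighbours suffice: after the loss of the
    ends of the avoided edge and of one end of the edge with its colour, five are left, enough for
    all of [S]. *)
Let L := [set a in S | #|nbr a| <= 7].

Let S_W : S \subset W. Proof. exact: subsetUl. Qed.
Let S_le_W : #|S| <= #|W|. Proof. exact: subset_leq_card. Qed.
Let cW : #|W| + #|~: W| = #|T|. Proof. exact: cardsC. Qed.

Let S_out x : x \in S -> x \notin ~: W.
Proof. by move=> xS; rewrite inE negbK (subsetP S_W). Qed.

Let dd_nbr v : dd [set v] (~: W) = #|nbr v|.
Proof. by rewrite pairs_between_sum big_set1. Qed.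

Let g_count : npairs g = dd W W + 2 * dd S (~: W).
Proof.
rewrite (npairs_split W) //.
have -> : dd (~: W) (~: W) = 0.
  apply/eqP; rewrite -leqn0 leqNgt; apply/negP=> /pairs_between_gt0[x [y]].
  by case=> /g_out; rewrite !inE => xy /xy yS; rewrite yS.
have -> : dd W (~: W) = dd S (~: W); last by rewrite addn0.
apply: eq_card => p; rewrite !inE; case: (boolP (g _ _)) => //= gp.
case: (boolP (p.2 \in W)) => [|pW]; first by rewrite inE => ->; rewrite !andbF.
rewrite (g_out _ pW) //; last by rewrite g_sym.
Qed.

(** With at most one vertex of [S] outside [L], there would be only about [2n] pairs instead of
    [4n], which is too few from 30 vertices on. *)
Lemma card_low : #|L| + 2 <= #|S|.
Proof.
have LS : L \subset S by apply/subsetP=> x; rewrite inE => /andP[].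
have ddS : dd S (~: W) <= #|L| * 7 + #|S :\: L| * #|~: W|.
  have SE : S = L :|: (S :\: L) by rewrite -[LHS](setID S L) (setIidPr LS).
  rewrite {1}SE pairs_betweenUl; last by rewrite -setI_eq0 setIDA setDIl setDv set0I.
  apply: leq_add; last exact: pairs_between_le.
  rewrite pairs_between_sum -sum_nat_const; apply: leq_sum => a.
  by rewrite inE => /andP[].
have dW := @planar_bound T g g_sym g_adj W _.
have cD : #|S :\: L| + #|L| = #|S| by rewrite addnC -{1}(setIidPr LS) cardsID.
move: g_big; rewrite g_count => big.
rewrite leqNgt; apply/negP=> lt.
have W3 : 2 < #|W| by lia.
have {}dW := dW W3.
have [d1|d0] : #|S :\: L| = 1 \/ #|S :\: L| = 0 by lia.
  rewrite d1 mul1n in ddS cD; move: ddS cD big dW cW W15 S_le_W S4 T30.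
  move: (dd S (~: W)) (dd W W) #|S| #|L| #|W| #|~: W| #|T| => *; lia.
rewrite d0 in ddS cD; move: ddS cD big dW cW W15 S_le_W S4 T30.
move: (dd S (~: W)) (dd W W) #|S| #|L| #|W| #|~: W| #|T| => *; lia.
Qed.

(** If a set [A] had a neighbourhood [N] of at most [#|A|] vertices outside [W], the planar bound on
    [W :|: N] and the bipartite bound between [S :\: A] and the remaining vertices would leave too
    few edges. *)
Lemma low_surplus : surplus L 1 nbr.
Proof.
move=> A AL A0; have AS : A \subset S.
  by apply/subsetP=> x /(subsetP AL); rewrite inE => /andP[].
have cA : #|A| + 2 <= #|S|.
  by apply: leq_trans card_low; rewrite leq_add2r; apply: subset_leq_card.
have cB : #|S :\: A| + #|A| = #|S| by rewrite addnC -{1}(setIidPr AS) cardsID.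
move: g_big; rewrite g_count => big.
(* For a single vertex the general count fails by the narrowest margin, and [g_local] provides the
   missing gain. *)
case: (altP (#|A| =P 1)) => [/eqP/cards1P[v Av]|A1].
  have vS : v \in S by rewrite -sub1set -Av.
  rewrite Av big_set1 cards1 -dd_nbr.
  have SE : S = [set v] :|: (S :\ v) by rewrite setD1K.
  have dv : [disjoint [set v] & S :\ v] by rewrite -setI_eq0 setIDA setDIl setDv set0I.
  rewrite {1}SE pairs_betweenUl // in big.
  have dB : [disjoint S :\ v & v |: ~: W].
    rewrite disjoint_sym -setI_eq0; apply/eqP/setP=> x; rewrite !inE.
    by case: (altP (x =P v)) => //= _; case: (x \in S); rewrite ?andbF.
  (* With [v] on the outer side, the bound also pays for the edges from [v] to the rest of [S],
     which [g_local] credits. *)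
  have := planar_bipartite_bound g_sym g_adj dB.
  rewrite pairs_betweenUr //; last by rewrite disjoints1 S_out.
  rewrite cardsU1 S_out // (pairs_between_sym (S :\ v)) //=.
  have := g_local vS; rewrite Av cards1 in cB.
  move: cB big W15 cW S4 T30.
  move: (dd [set v] (S :\ v)) (dd [set v] (~: W)) (dd (S :\ v) (~: W)) (dd W W)
    #|S :\ v| #|S| #|W| #|~: W| #|T| => *; lia.
set N := \bigcup_(a in A) nbr a.
have NW : N \subset ~: W.
  by apply/subsetP=> i /bigcupP[a _]; rewrite inE => /andP[].
have dWN : [disjoint W & N].
  by apply: disjointWr NW _; rewrite -setI_eq0 setICr.
have cWN : #|W :|: N| = #|W| + #|N|.
  by rewrite cardsU (disjoint_setI0 dWN) cards0 subn0.
have cN : #|~: W :\: N| + #|N| = #|~: W|.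
  by rewrite addnC -{1}(setIidPr NW) cardsID.
have dBN : [disjoint S :\: A & ~: W :\: N].
  rewrite -setI_eq0; apply/eqP/setP=> x; rewrite !inE.
  by case: (x \in S); rewrite /= ?andbF.
have cnt : npairs g <= dd (W :|: N) (W :|: N) + 2 * dd (S :\: A) (~: W :\: N).
  rewrite (npairs_split (W :|: N)) // setCU -setDE.
  have -> : dd (~: W :\: N) (~: W :\: N) = 0.
    apply/eqP; rewrite -leqn0 leqNgt; apply/negP=> /pairs_between_gt0[x [y]].
    case=> /g_out xy; rewrite inE => /andP[_]; rewrite inE => /xy yS.
    by rewrite inE (negPf (S_out yS)) andbF.
  rewrite addn0 leq_add2l leq_mul2l /=; apply: subset_leq_card.
  apply/subsetP=> [[x y]]; rewrite inE [in X in _ -> X]inE /= => /and3P[xy _ yN].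
  rewrite xy yN andbT /=; move: yN; rewrite inE => /andP[yN yW].
  have xS : x \in S by apply: (g_out (x := y)); [rewrite g_sym | rewrite inE in yW].
  rewrite inE xS andbT; apply: contra yN => xA; apply/bigcupP; exists x => //.
  by rewrite inE yW.
have A2 : 2 <= #|A| by rewrite ltn_neqAle eq_sym A1 card_gt0.
rewrite addn1 ltnNge; apply/negP=> NA.
have I23 : 23 <= #|~: W| by clear -cW W15 S4 T30; lia.
have IN18 : 2 < #|~: W :\: N| by clear -I23 cN NA cA W15 S_le_W; lia.
have b1 : dd (S :\: A) (~: W :\: N) + 4 <= 2 * (#|S :\: A| + #|~: W :\: N|).
  by apply: planar_bipartite_bound => //; apply: leq_trans IN18 _; apply: leq_addl.
have WN3 : 2 < #|W :|: N| by clear -cWN S4 S_le_W; lia.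
have b2 := planar_bound g_sym g_adj WN3.
rewrite cWN in b2; rewrite -g_count in big.
move: b1 b2 cnt big cN cB W15 cW NA A2.
move: (dd (W :|: N) (W :|: N)) (dd (S :\: A) (~: W :\: N)) (npairs g).
move: #|~: W :\: N| #|S :\: A| #|A| #|N| #|S| #|W| #|~: W| #|T|.
clear => *; lia.
Qed.

(* The edge [xy] is found first; [uv] will be the edge of [g] of the same colour. *)
Lemma robust_matching : exists x y, [/\ adj x y, x \notin W, y \notin W &
  forall u v : T, exists f : T -> T, [/\ {in S &, injective f},
    {in S, forall a, [/\ g a (f a), f a \notin W, f a != x & f a != y]} &
    {in S, forall a, [set a; f a] != [set u; v]}]].
Proof.
have [N [sN subN cN]] := surplus_thin low_surplus.
pose Y := \bigcup_(a in L) N a.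
have cY : #|Y| <= 2 * #|L|.
  rewrite mulnC -sum_nat_const; apply: (@leq_trans (\sum_(a in L) #|N a|));
    last exact: leq_sum.
  rewrite /Y; elim/big_rec2: _ => [|a m B aL le]; first by rewrite cards0.
  by rewrite cardsU; lia.
(* Here [#|W| + 2 * (#|S| - 2)] is at most [15 - 4], and [3 * 11 < 30 + 4] is what [edge_avoiding]
   requires. *)
have cK : #|W :|: Y| <= 11.
  by have := card_low; have := cardsU W Y; lia.
have [x [y [xy]]] : exists x y : T, [/\ adj x y, x \notin W :|: Y & y \notin W :|: Y].
  by apply: edge_avoiding; lia.
rewrite !inE !negb_or -/Y => /andP[xW xY] /andP[yW yY].
exists x, y; split=> // [||u v]; try by rewrite inE negb_or.
(* Forbidding the edge [uv] costs the vertices of [S] at most this one outer neighbour. *)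
pose z := if u \in S then v else u.
have zP a i : a \in S -> i \notin S -> [set a; i] = [set u; v] -> i = z.
  move=> aS iS aiE; have : i \in [set u; v] by rewrite -aiE !inE eqxx orbT.
  have : u \in [set a; i] by rewrite aiE !inE eqxx.
  rewrite /z !inE; case: (boolP (u \in S)) => uS ua iu.
    by case/orP: iu => /eqP // iu; rewrite iu uS in iS.
  by case/orP: ua => /eqP // ua; rewrite ua aS in uS.
pose M a := [set i in nbr a | [&& i != x, i != y & [set a; i] != [set u; v]]].
have iNS a i : i \in nbr a -> i \notin S.
  by rewrite inE => /andP[iW _]; apply: contraL iW => /S_out.
have [|f [finj fM]] := @hall T T x S M.
  (* Hall's condition: within [L] the surplus makes up for the loss of [z], and the thinned sets
     avoid [x] and [y] already; a vertex outside [L] has five choices by itself. *)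
  move=> A AS; case: (set_0Vmem A) => [->|[a aA]]; first by rewrite cards0.
  case: (boolP (A \subset L)) => [AL|].
    have sub : (\bigcup_(a in A) N a) :\ z \subset \bigcup_(a in A) M a.
      apply/subsetP=> i; rewrite in_setD1 => /andP[iz /bigcupP[b bA iN]].
      apply/bigcupP; exists b => //; have inb := subsetP (subN b) _ iN.
      rewrite inE inb /=.
      have iY : i \in Y by apply/bigcupP; exists b => //; apply: (subsetP AL).
      apply/and3P; split; first by apply: contraNneq xY => <-.
        by apply: contraNneq yY => <-.
      apply: contraNneq iz => /zP -> //; first exact: (subsetP AS).
      exact: iNS inb.
    apply: leq_trans (subset_leq_card sub).
    have := sN A AL; rewrite (cardsD1 z (\bigcup_(a in A) N a)).
    have -> : A != set0 by apply/set0Pn; exists a.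
    move/(_ isT); rewrite addn1 => le; rewrite -ltnS; apply: leq_trans le _.
    by rewrite -[X in _ <= X]add1n leq_add2r leq_b1.
  case/subsetPn=> b bA bL; have bS := subsetP AS _ bA.
  have b8 : 8 <= #|nbr b| by move: bL; rewrite inE bS /= -ltnNge.
  have sub : nbr b \subset x |: (y |: (z |: M b)).
    apply/subsetP=> i inb; rewrite !in_setU !in_set1 [i \in M b]inE inb /=.
    case: (altP (i =P x)) => //= _; case: (altP (i =P y)) => //= _.
    case: (altP (i =P z)) => //= iz; apply: contraNneq iz => /zP -> //.
    exact: iNS inb.
  have Mb : #|M b| <= #|\bigcup_(a in A) M a|.
    by apply/subset_leq_card/bigcup_sup.
  have M5 : 5 <= #|M b|.
    have := leq_trans b8 (subset_leq_card sub); rewrite !cardsU1.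
    do 3![case: (_ \notin _)]; move: #|M b|; clear => *; lia.
  apply: leq_trans (subset_leq_card AS) (leq_trans _ (leq_trans M5 Mb)).
  by move: S_le_W W15; clear; move: #|S| #|W| => *; lia.
exists f; split=> // a aS; have := fM a aS.
  by rewrite inE => /andP[]; rewrite !inE => /andP[fW ->] /and3P[-> ->].
by rewrite inE => /and4P[].
Qed.

End RobustMatching.

(** * Dense subgraphs without six disjoint edges *)

Section Barrier.

Variables (V : finType) (g : rel V) (S : {set V}) (m : {ffun V -> V}).
Hypotheses (g_sym : symmetric g) (g_irr : irreflexive g).
Hypothesis m_match : is_matching g (~: S) m.
Hypothesis m_comp : forall x y, m x = x -> m y = y ->
  connect (restrict g (~: S)) x y -> x = y.

Let restrict_sym : symmetric (restrict g (~: S)).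
Proof. by move=> x y; rewrite /restrict g_sym [_ && (_ \in ~: S)]andbC. Qed.

(** The uncovered vertices lie in distinct components. *)
Lemma fixed_components : #|V| <= n_comp (restrict g (~: S)) V + #|moved m|.
Proof.
have cs := sym_connect_sym restrict_sym.
rewrite -(cardsC (moved m)) addnC leq_add2r.
rewrite -(card_in_imset (f := root (restrict g (~: S)))); last first.
  move=> x y; rewrite !inE !negbK => /eqP mx /eqP my /eqP.
  by rewrite root_connect //; apply: m_comp.
apply/subset_leq_card/subsetP=> _ /imsetP[x _ ->].
by rewrite !inE andbT; apply: roots_root.
Qed.

Definition nonisolated := [set x in ~: S | [exists y in ~: S, g x y]].

(** An uncovered nonisolated vertex has a covered neighbour, whose partner is in the same component.
    As its component contains no other uncovered vertex, there are at most half as many such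
    vertices as covered ones. *)
Lemma card_nonisolated : 2 * #|nonisolated| <= 3 * #|moved m|.
Proof.
have mK := matchingK m_match.
pose F := nonisolated :\: moved m.
pose nb x := odflt x [pick y in ~: S | g x y].
have nbP x : x \in F -> [/\ m x = x, restrict g (~: S) x (nb x) & m (nb x) != nb x].
  rewrite 3!inE negbK => /and3P[/eqP mx xS /existsP[y /andP[yS xy]]].
  rewrite /nb; case: pickP => [z /andP[zS xz]|/(_ y)]; last by rewrite yS xy.
  have r : restrict g (~: S) x z by rewrite /restrict xz xS zS.
  split=> //; apply: contraTneq xz => mz.
  by rewrite /= (m_comp mx mz (connect1 r)) g_irr.
have nbm x : x \in F -> restrict g (~: S) (nb x) (m (nb x)).
  by case/nbP=> _ _ /(matching_edge m_match).
have conn x : x \in F -> connect (restrict g (~: S)) x (nb x).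
  by case/nbP=> _ /connect1.
have connm x : x \in F -> connect (restrict g (~: S)) x (m (nb x)).
  by move=> xF; apply: connect_trans (conn x xF) (connect1 (nbm x xF)).
have same x y z : x \in F -> y \in F -> connect (restrict g (~: S)) x z ->
    connect (restrict g (~: S)) y z -> x = y.
  move=> /nbP[mx _ _] /nbP[my _ _] xz yz; apply: m_comp => //.
  by apply: connect_trans xz _; rewrite (sym_connect_sym restrict_sym).
pose F1 := nb @: F; pose F2 := (m \o nb) @: F.
have c1 : #|F1| = #|F|.
  apply: card_in_imset => x y xF yF E; apply: (same x y (nb x)) => //; first exact:
    conn.
  by rewrite E; apply: conn.
have c2 : #|F2| = #|F|.
  apply: card_in_imset => x y xF yF E; apply: (same x y (m (nb x))) => //;
    first exact: connm.
  by rewrite [m _]E; apply: connm.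
have d12 : F1 :&: F2 = set0.
  apply/setP=> z; rewrite !inE; apply/andP=> -[/imsetP[x xF zx] /imsetP[y yF zy]].
  have xy : x = y.
    by apply: (same x y z) => //; [rewrite zx; apply: conn | rewrite zy; apply: connm].
  by subst y; have [_ _ /eqP[]] := nbP x xF; rewrite -[RHS]zx zy.
have sub : F1 :|: F2 \subset moved m.
  apply/subsetP=> z; rewrite !inE => /orP[/imsetP[x xF ->]|/imsetP[x xF ->]].
    by case: (nbP x xF).
  by rewrite /= mK eq_sym; case: (nbP x xF).
have := subset_leq_card sub; rewrite cardsU d12 cards0 c1 c2 subn0.
have := cardsID (moved m) nonisolated; rewrite -/F.
have := subset_leq_card (subsetIr nonisolated (moved m)).
move: #|F| #|nonisolated| #|moved m| #|_ :&: _| => *; lia.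
Qed.

Lemma nonisolated_pairs : pairs_between g (~: S) (~: S) =
  pairs_between g nonisolated nonisolated.
Proof.
apply: eq_card => [[x y]]; rewrite !inE /=; case: (boolP (g x y)) => //= xy.
case: (boolP (x \in S)) => //= xS; case: (boolP (y \in S)) => yS; rewrite /= ?andbF //.
apply/esym/andP; split; apply/existsP; first by exists y; rewrite inE yS.
by exists x; rewrite inE xS g_sym.
Qed.

Lemma disjoint_nonisolated : [disjoint S & nonisolated].
Proof.
by rewrite -setI_eq0; apply/eqP/setP=> x; rewrite !inE; case: (x \in S).
Qed.

End Barrier.

Section Dense.

Variable T : plane_triangulation.
Variable g : rel T.
Hypothesis T30 : 30 <= #|T|.
Hypothesis g_sym : symmetric g.
Hypothesis g_adj : subrel g (@adj T).
Hypothesis g_big : 4 * #|T| + 8 <= npairs g.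
Hypothesis g_match : forall f, is_matching g setT f -> #|moved f| <= 10.
Local Notation dd := (pairs_between g).

Let g_irr : irreflexive g.
Proof. by move=> x; apply: contraFF (adj_irrefl x) => /g_adj. Qed.

(** No edge joins [P] to [S :\: P], so the two parts contribute at most two separate cliques; [p] is
    the size of [P]. *)
Lemma pairs_split_clique (S P : {set T}) : P \subset S -> P != set0 -> P != S ->
  (forall x y, x \in P -> y \in S -> y \notin P -> ~~ g x y) ->
  exists p, [/\ 0 < p, p < #|S| & dd S S <= p * p.-1 + (#|S| - p) * (#|S| - p).-1].
Proof.
move=> PS P0 PnS nP; have SE : S = P :|: (S :\: P) by rewrite -[LHS](setID S P)
  (setIidPr PS).
have d : [disjoint P & S :\: P] by rewrite -setI_eq0 setIDA setDIl setDv set0I.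
have cP := cardsID P S; rewrite (setIidPr PS) in cP.
exists #|P|; split; first by rewrite card_gt0.
  by apply: proper_card; rewrite properEneq PnS.
rewrite {1 2}SE pairs_between_square //.
have -> : dd P (S :\: P) = 0.
  apply/eqP; rewrite -leqn0 leqNgt; apply/negP=> /pairs_between_gt0[x [y]].
  by case=> xy xP; rewrite inE => /andP[yP yS]; have := nP x y xP yS yP; rewrite xy.
rewrite muln0 addn0 (_ : #|S| - #|P| = #|S :\: P|); last by rewrite -cP; lia.
by apply: leq_add; apply: pairs_between_clique.
Qed.

(** Five edges of [g] that form a matching of six together with [xy], none of them equal to [uv]. *)
Definition rainbow_candidate (x y u v : T) (s : seq (T * T)) :=
  [/\ size s = 5, uniq ((x :: map fst s) ++ (y :: map snd s)),
      {in s, forall p, g p.1 p.2} &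
      {in s, forall p, [set p.1; p.2] != [set u; v]}].

(** The edges given by [f] join [S] to vertices outside [S :|: E], and those of [t] stay inside [E],
    so the two kinds never meet. *)
Lemma candidate_of_matching (S E : {set T}) (t : seq (T * T)) x y u v f :
  #|S| + size t = 5 ->
  [disjoint S & E] -> x \notin S :|: E -> y \notin S :|: E -> x != y ->
  {in S &, injective f} ->
  {in S, forall a, [/\ g a (f a), f a \notin S :|: E, f a != x & f a != y]} ->
  {in S, forall a, [set a; f a] != [set u; v]} ->
  uniq (map fst t ++ map snd t) ->
  {in t, forall p, [/\ g p.1 p.2, p.1 \in E & p.2 \in E]} ->
  {in t, forall p, [set p.1; p.2] != [set u; v]} ->
  exists s, rainbow_candidate x y u v s.
Proof.
move=> sz dSE xW yW xy finj fP fuv ut tP tuv.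
exists ([seq (a, f a) | a <- enum S] ++ t); split.
- by rewrite size_cat size_map -cardE.
- have tE b : (b \in map fst t) || (b \in map snd t) -> b \in E.
    by case/orP=> /mapP[p pt ->]; case: (tP p pt).
  have fE b : b \in [seq f a | a <- enum S] -> [/\ b \notin S, b \notin E,
    b != x & b != y].
    case/mapP=> a; rewrite mem_enum => aS ->; have [_ + -> ->] := fP a aS.
    by rewrite inE negb_or => /andP[].
  have e1 : map fst [seq (a, f a) | a <- enum S] = enum S.
    by rewrite -map_comp; apply: map_id.
  have e2 : map snd [seq (a, f a) | a <- enum S] = [seq f a | a <- enum S].
    by rewrite -map_comp.
  rewrite !map_cat e1 e2.
  have perm : perm_eq ((x :: enum S ++ map fst t) ++ y ::
    [seq f a | a <- enum S] ++ map snd t)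
     ([:: x; y] ++ ((enum S ++ [seq f a | a <- enum S]) ++ (map fst t ++ map snd t))).
    by apply/seq.permP=> P; rewrite /= !count_cat /= !count_cat; lia.
  rewrite (perm_uniq perm) cat_uniq [uniq [:: x; y]]/= inE xy [X in X && _]/= andTb.
  rewrite !inE in xW yW; case/norP: xW yW => xS xE /norP[yS yE].
  have nxy z : z \notin S -> z \notin E -> (z == x) || (z == y) ->
     z \in (enum S ++ [seq f a | a <- enum S]) ++ map fst t ++ map snd t = false.
    move=> zS zE zxy; rewrite !mem_cat mem_enum (negPf zS) /=.
    apply/negP => /or3P[/fE[_ _ zx zy]|zt|zt].
    - by rewrite (negPf zx) (negPf zy) in zxy.
    - by rewrite tE ?zt // in zE.
    by rewrite tE ?zt ?orbT // in zE.
  apply/andP; split.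
    apply/hasPn=> z zs; rewrite !inE; apply: contraL zs => zxy.
    by case/orP: (zxy) => /eqP E'; rewrite nxy // E' // ?eqxx ?orbT.
  rewrite cat_uniq ut andbT cat_uniq enum_uniq /= map_inj_in_uniq ?enum_uniq;
    last first.
    by move=> a b; rewrite !mem_enum; apply: finj.
  rewrite andbT; apply/andP; split; apply/hasPn=> z.
    by case/fE=> zS _ _ _; rewrite mem_enum.
  rewrite mem_cat => /tE zE; rewrite mem_cat mem_enum (disjointFl dSE zE) /=.
  by apply/negP=> /fE[_]; rewrite zE.
- move=> p; rewrite mem_cat => /orP[/mapP[a]|/tP[]//].
  by rewrite mem_enum => /fP[] ? _ _ _ ->.
move=> p; rewrite mem_cat => /orP[/mapP[a]|/tuv//].
by rewrite mem_enum => /fuv ? ->.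
Qed.

Lemma dense_structure : exists x y, adj x y /\
  forall u v : T, exists s, rainbow_candidate x y u v s.
Proof.
have [S [m [mm mc [m' m'm le]]]] := gallai_edmonds g_sym g_irr.
have {le m'm m'} le : 2 * #|S| + #|moved m| <= 10 := leq_trans le (g_match m'm).
have cD := card_nonisolated g_sym g_irr mm mc.
have nD := nonisolated_pairs S g_sym.
have dD := disjoint_nonisolated g S.
set E := nonisolated g S in cD nD dD.
have comp : #|T| <= n_comp (inner_edges g S) T + #|moved m|.
  rewrite (eq_n_comp (e' := restrict g (~: S))); first exact: fixed_components.
  by apply: eq_connect => x y; rewrite /inner_edges /restrict !inE.
have sep := separator_bound S g_sym g_adj.
have cO := card_outer_regions S g_sym.
set q := #|outer_regions g S| in sep cO.
have split2 : 1 < q -> exists p,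
    [/\ 0 < p, p < #|S| & dd S S <= p * p.-1 + (#|S| - p) * (#|S| - p).-1].
  by case/(outer_regions_split g_sym g_adj)=> P [PS P0 PnS] nP; apply:
    pairs_split_clique nP.
have spl := npairs_split S g_sym.
have clq := pairs_between_clique S g_irr.
have ddE : dd E E <= maxn 2 (6 * #|E| - 12).
  case: (ltnP 2 #|E|) => [E3|E2]; first by have := planar_bound g_sym g_adj E3; lia.
  by have := pairs_between_clique E g_irr; case: #|E| E2 => [|[|[|]]] //; lia.
have out x y : g x y -> x \notin S :|: E -> y \in S.
  move=> xy; rewrite !inE => /norP[xS]; rewrite xS /= => /existsPn/(_ y).
  by rewrite xy andbT inE negbK.
have cW : #|S :|: E| = #|S| + #|E|.
  by rewrite cardsU (disjoint_setI0 dD) cards0 subn0.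
(* In the sum of [separator_bound], the bound on components and [g_big], the terms in [#|T|]
   cancel. *)
have key : 2 * #|moved m| + dd S S + 2 * q >= 18.
  move: sep spl comp g_big; clear.
  move: (dd S S) (dd S (~: S)) (dd (~: S) (~: S)) (npairs g) #|T| #|moved m| q.
  by move: (n_comp (inner_edges g S) T) => *; lia.
have cS := cardsC S.
have le1 : dd S (~: S) <= #|S| * #|~: S| := pairs_between_le g S (~: S).
have s5 : #|S| <= 5 by move: le; clear; move: #|S| #|moved m| => *; lia.
rewrite nD in spl.
(* One vertex of [S] accounts for at most [2n] pairs, and [E] has at most 15 vertices. *)
have s2 : 2 <= #|S|.
  rewrite ltnNge; apply/negP=> s1.
  move: cD le spl clq ddE cS le1 g_big T30 s1; clear.
  move: (dd S S) (dd S (~: S)) (dd E E) (npairs g) #|T| #|moved m| #|~: S| #|E|.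
  by case: #|S| => [|[|//]] *; lia.
have s4 : 4 <= #|S|.
  rewrite ltnNge; apply/negP=> s3.
  have : dd S S + 2 * q <= 2 * #|S| + (#|S| == 3) * 2.
    case: (ltnP 1 q) => [/split2[p [p0 pS ddp]]|q1].
      move: cO p0 pS ddp s2 s3; clear; move: (dd S S) q #|S| => a b.
      by case=> [|[|[|[|//]]]] //; case: p => [|[|[|//]]] //=; lia.
    move: clq q1 s2 s3; clear; move: (dd S S) q #|S| => a b.
    by case=> [|[|[|[|//]]]] //=; lia.
  move: key le s2 s3; clear; move: (dd S S) q #|moved m| #|S| => a b c.
  by case=> [|[|[|[|//]]]] //=; lia.
have S_E x : x \in S -> x \notin E by move=> xS; rewrite inE inE xS.
have robust := robust_matching T30 g_sym g_adj g_big out s4.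
(* The vertices of [S] other than [v] span at most a clique; this supplies [g_local] for
   [robust_matching] in both cases. *)
have ddv v : v \in S -> dd S S <= 2 * dd [set v] (S :\ v) + (#|S| - 1) * (#|S| - 2).
  move=> vS; have dv : [disjoint [set v] & S :\ v] by rewrite disjoints1 !inE eqxx.
  rewrite -{1 2}(setD1K vS) pairs_between_square //.
  have := pairs_between_clique [set v] g_irr; rewrite cards1 /= muln0 leqn0 => /eqP->.
  rewrite add0n leq_add2l; have := pairs_between_clique (S :\ v) g_irr.
  by rewrite (cardsD1 v S) vS add1n !subSS subn0 subn1.
have ne (x y : T) : adj x y -> x != y.
  by apply: contraTneq => ->; rewrite adj_irrefl.
have [s_4|s_5] : #|S| = 4 \/ #|S| = 5 by move: s4 s5; clear; move: #|S|; lia.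
  have E3 : #|E| <= 3 by move: cD le s_4; clear; move: #|E| #|S| #|moved m| => *; lia.
  have sb : 2 * dd S (~: S) + 8 <= 4 * #|T|.
    have dS : [disjoint S & ~: S] by rewrite -setI_eq0 setICr.
    have := planar_bipartite_bound g_sym g_adj dS; rewrite cS.
    by move: T30; clear; move: (dd S (~: S)) #|T| => a b *; lia.
  have E6 : dd E E <= 6.
    by apply: leq_trans ddE _; rewrite geq_max /=; move: E3; clear; lia.
  (* A split [S] would span at most six pairs, giving at most [6 + 6 + 4n - 8] in total. *)
  have q1 : q <= 1.
    rewrite leqNgt; apply/negP=> /split2[p [p0 pS ddp]]; rewrite s_4 in pS ddp.
    move: p0 pS ddp spl sb g_big E6; clear.
    move: (dd S S) (dd E E) (dd S (~: S)) (npairs g) #|T| => a b c d e.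
    by case: p => [|[|[|[|//]]]] //=; lia.
  have dSS : dd S S = 12.
    move: clq key le q1; rewrite s_4; clear; move: (dd S S) q #|moved m| => *; lia.
  (* At least two edges lie inside [E], so one of them differs from [uv] and completes the four
     edges at [S]. *)
  have E4 : 4 <= dd E E.
    move: spl sb g_big; rewrite dSS; clear.
    by move: (dd E E) (dd S (~: S)) (npairs g) #|T| => *; lia.
  have [||x [y [xy xW yW hf]]] := robust.
  - by rewrite cW s_4; move: E3; clear; lia.
  - move=> v /ddv; rewrite s_4 dSS => dv.
    have W3 : 2 < #|S :|: E| by rewrite cW s_4.
    have := planar_bound g_sym g_adj W3; move: dv; clear.
    move: (dd (S :|: E) (S :|: E)) #|S :|: E| (dd [set v] (S :\ v)) => *; lia.
  exists x, y; split=> // u v; have [f [finj fP fuv]] := hf u v.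
  have [p [pq [pE qE]]] : exists p : T * T,
      g p.1 p.2 /\ [/\ p.1 \in E, p.2 \in E & [set p.1; p.2] != [set u; v]].
    case: (pickP [pred p : T * T | [&& g p.1 p.2, p.1 \in E, p.2 \in E
                                     & [set p.1; p.2] != [set u; v]]]) => [p|none].
      by case/and4P=> ? ? ? ?; exists p.
    suff : dd E E <= #|[set (u, v); (v, u)]|.
      by move/(leq_trans E4); rewrite cards2; case: (_ != _).
    apply/subset_leq_card/subsetP=> [[a b]]; rewrite inE /= => /and3P[ab aE bE].
    have := none (a, b); rewrite /= ab aE bE /= => /negbFE/eqP ab_uv.
    have : a \in [set u; v] by rewrite -ab_uv !inE eqxx.
    have : b \in [set u; v] by rewrite -ab_uv !inE eqxx orbT.
    have nab := ne _ _ (g_adj ab).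
    rewrite !inE !xpair_eqE => /orP[]/eqP bu /orP[]/eqP au; move: nab;
      by rewrite au bu !eqxx ?orbT.
  move=> puv; apply: (@candidate_of_matching S E [:: p] x y u v f) => //=.
  - by rewrite s_4.
  - exact: ne.
  - by rewrite inE andbT; apply: ne (g_adj pq).
  - by move=> r; rewrite inE => /eqP->.
  - by move=> r; rewrite inE => /eqP->.
(* With five vertices in [S], the matching [m] is empty and [G - S] has no edges. *)
have E0 : E = set0.
  by apply: cards0_eq; move: cD le; rewrite s_5; clear; move: #|E| #|moved m| => *; lia.
have [||x [y [xy xW yW hf]]] := robust.
- by rewrite cW s_5 E0 cards0.
- move=> v /ddv; rewrite E0 setU0 s_5; clear.
  by move: (dd S S) (dd [set v] (S :\ v)) => *; lia.
exists x, y; split=> // u v; have [f [finj fP fuv]] := hf u v.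
apply: (@candidate_of_matching S E [::] x y u v f) => //=; first by rewrite s_5.
exact: ne.
Qed.

End Dense.

(** * The upper bound *)

Lemma rainbow_of_tuple (G : sgraph) (C : eqType) (c : {set G} -> C) k
    (t : k.-tuple (G * G)) :
  uniq (map fst t ++ map snd t) -> {in t, forall p, adj p.1 p.2} ->
  uniq [seq c [set p.1; p.2] | p <- t] -> has_rainbow (matching k) c.
Proof.
rewrite cat_uniq => /and3P[u1 /hasPn u12 u2] tadj uc.
have inj1 : injective (fun i => (tnth t i).1).
  have /tuple_uniqP inj : uniq (map_tuple fst t) by [].
  by move=> i j E; apply: inj; rewrite !tnth_map.
have inj2 : injective (fun i => (tnth t i).2).
  have /tuple_uniqP inj : uniq (map_tuple snd t) by [].
  by move=> i j E; apply: inj; rewrite !tnth_map.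
have n12 i j : (tnth t i).1 <> (tnth t j).2.
  move=> E; have /u12 := map_f snd (mem_tnth j t).
  by rewrite /= -E map_f ?mem_tnth.
pose f (u : 'I_k * bool) : G := if u.2 then (tnth t u.1).2 else (tnth t u.1).1.
exists f; split.
  split=> [[i b] [j d]|[i b] [j d]]; rewrite /f.
    by case: b d => [] [] /= => [/inj2->|/esym/n12|/n12|/inj1->].
  case/andP=> /= /eqP-> bd; have := tadj _ (mem_tnth j t).
  by case: b d bd => [] [] //= _; rewrite // adj_sym.
have edgeE e : e \in edges (matching k) -> exists i : 'I_k,
    e = [set (i, false); (i, true)] /\ f @: e = [set (tnth t i).1; (tnth t i).2].
  case/imsetP=> [[[i b] [j d]]]; rewrite inE => /andP[/= /eqP-> bd] ->; exists j.
  rewrite imsetU1 imset_set1 /f /=.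
  by case: b d bd => [] [] //= _; split=> //; rewrite setUC.
move=> e e' /edgeE[i [-> ->]] /edgeE[j [-> ->]] E.
suff -> : i = j by [].
have /tuple_uniqP inj : uniq (map_tuple (fun p => c [set p.1; p.2]) t) by [].
by apply: inj; rewrite !tnth_map.
Qed.

Lemma uniq_pair_set (V : finType) (s : seq (V * V)) p q :
  uniq (map fst s ++ map snd s) -> p \in s -> q \in s ->
  [set p.1; p.2] = [set q.1; q.2] -> p = q.
Proof.
rewrite cat_uniq => /and3P[_ /hasPn u12 _] ps qs E.
have n12 a b : a \in s -> b \in s -> a.1 <> b.2.
  by move=> sa sb ab; have /u12 := map_f snd sb; rewrite /= -ab map_f.
have : p.1 \in [set q.1; q.2] by rewrite -E !inE eqxx.
have : p.2 \in [set q.1; q.2] by rewrite -E !inE eqxx orbT.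
rewrite !inE => /orP[/eqP/esym/(n12 _ _ qs ps)//|/eqP e2].
case/orP=> [/eqP e1|/eqP/(n12 _ _ ps qs)//].
by rewrite [p]surjective_pairing e1 e2 -surjective_pairing.
Qed.

Section Upper.

Variable T : plane_triangulation.
Variables (k : nat) (c : {set T} -> 'I_k).
Hypothesis T30 : 30 <= #|T|.
Hypothesis c_onto : edge_coloring c.
Hypothesis k_big : 2 * #|T| + 4 <= k.

(** The chosen edge of each colour; the default [set0] never occurs, as all colours do. *)
Let rep (i : 'I_k) : {set T} := odflt set0 [pick e in edges T | c e == i].

Let repP i : rep i \in edges T /\ c (rep i) = i.
Proof.
rewrite /rep; case: pickP => [e /andP[eT /eqP //]|none].
by have [e eT ce] := c_onto i; have := none e; rewrite eT ce eqxx.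
Qed.

Let g : rel T := fun x y => adj x y && (rep (c [set x; y]) == [set x; y]).

Let g_sym : symmetric g.
Proof. by move=> x y; rewrite /g adj_sym setUC. Qed.

Let g_adj : subrel g (@adj T). Proof. by move=> x y /andP[]. Qed.

Let g_big : 4 * #|T| + 8 <= npairs g.
Proof.
have rep_inj : injective rep.
  by move=> i j E; have [_ <-] := repP i; have [_ <-] := repP j; rewrite E.
suff -> : npairs g = 2 * #|[set rep i | i in 'I_k]|.
  by rewrite card_imset // card_ord; move: k_big; clear; move: #|T|; lia.
rewrite -card_edge_pairs; last by apply/subsetP=> _ /imsetP[i _ ->]; case: (repP i).
apply: eq_card => p; rewrite !inE /g; congr andb; apply/eqP/imsetP => [<-|[i _ E]].
  by exists (c [set p.1; p.2]).
by rewrite E; have [_ ->] := repP i.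
Qed.

Lemma uniq_colors (s : seq (T * T)) : uniq (map fst s ++ map snd s) ->
  {in s, forall p, g p.1 p.2} -> uniq [seq c [set p.1; p.2] | p <- s].
Proof.
move=> us gs; rewrite map_inj_in_uniq.
  by move: us; rewrite cat_uniq => /andP[/map_uniq].
move=> p q ps qs cE; apply: (uniq_pair_set us) => //.
by have /andP[_ /eqP<-] := gs p ps; have /andP[_ /eqP<-] := gs q qs; rewrite cE.
Qed.

Lemma rainbow_of_matching (f : {ffun T -> T}) :
  is_matching g setT f -> 10 < #|moved f| -> has_rainbow (matching 6) c.
Proof.
move=> fm; have fK := matchingK fm; rewrite (card_moved fK) => A6.
pose A := matching_half f; pose s := [seq (x, f x) | x <- take 6 (enum A)].
have e1 : map fst s = take 6 (enum A) by rewrite -map_comp; apply: map_id.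
have e2 : map snd s = map f (take 6 (enum A)) by rewrite -map_comp.
have tA x : x \in take 6 (enum A) -> enum_rank x < enum_rank (f x).
  by move/mem_take; rewrite mem_enum inE.
have sz : size s == 6.
  rewrite size_map size_takel // -cardE; move: A6; rewrite -/A; move: #|A|; lia.
have us : uniq (map fst s ++ map snd s).
  rewrite e1 e2 cat_uniq map_inj_uniq ?take_uniq ?enum_uniq //=; last exact: inv_inj.
  rewrite andbT; apply/hasPn=> _ /mapP[y /tA ly ->]; apply/negP => /tA.
  by rewrite fK; move: ly; lia.
have sg : {in s, forall p, g p.1 p.2}.
  move=> _ /mapP[x /tA lx ->] /=.
  have fx : f x != x by apply: contraTneq lx => ->; rewrite ltnn.
  by case/and3P: (matching_edge fm fx).
apply: (@rainbow_of_tuple _ _ _ _ (Tuple sz)) => //.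
  by move=> p /sg/g_adj.
exact: uniq_colors.
Qed.

Lemma rainbow_exists : has_rainbow (matching 6) c.
Proof.
case: (boolP [exists f : {ffun T -> T}, is_matching g setT f && (10 < #|moved f|)]).
  by case/existsP=> f /andP[fm f10]; apply: rainbow_of_matching f10.
move/existsPn=> small.
have g_match f : is_matching g setT f -> #|moved f| <= 10.
  by move=> fm; have := small f; rewrite fm /= -leqNgt.
have [x [y [xy hxy]]] := dense_structure T30 g_sym g_adj g_big g_match.
(* The edge [uv] is the only edge of [g] with the colour of [xy], so a candidate avoiding it stays
   rainbow when [xy] is added. *)
have [/imsetP[[u v] _ uvE] cuv] := repP (c [set x; y]).
have [s [sz us sg suv]] := hxy u v.
have sz' : size ((x, y) :: s) == 6 by rewrite /= sz.
apply: (@rainbow_of_tuple _ _ _ _ (Tuple sz')) => //=.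
  by move=> p; rewrite inE => /orP[/eqP->|/sg/g_adj].
rewrite uniq_colors // ?andbT.
  apply/mapP=> -[p ps E]; have := suv p ps; have /andP[_ /eqP<-] := sg p ps.
  by rewrite -E uvE eqxx.
move: us; rewrite /= cat_uniq /= => /andP[_ /and3P[us1 us2 /andP[_ us3]]].
rewrite cat_uniq us1 us3 andbT /=; apply: contra us2 => ->; exact: orbT.
Qed.

End Upper.

(** * Constructing triangulations *)

(* [tau x y] is the third vertex of the face lying to the left of the dart
   [(x, y)]. *)
Record triangulated (V : finType) (a : rel V) (tau : V -> V -> V) : Prop := {
  tri_sym : symmetric a;
  tri_irr : irreflexive a;
  tri_next : forall x y, a x y -> a y (tau x y);
  tri_cycle : forall x y, a x y -> tau y (tau x y) = x;
  tri_link : forall v x y, a v x -> a v y -> fconnect (tau^~ v) x y;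
  tri_connected : forall x y, connect a x y;
  tri_card : npairs a + 12 = 6 * #|V|;
  tri_order : 3 <= #|V| }.

Section Realize.

Variables (V : finType) (a : rel V) (tau : V -> V -> V).
Hypothesis H : triangulated a tau.
Let G := SGraph (tri_sym H) (tri_irr H).
Local Notation rev := (@Defs.rev G).

Definition next_dart (d : dart G) : dart G :=
  exist (fun p : G * G => adj p.1 p.2) ((val d).2, tau (val d).1 (val d).2)
    (tri_next H (valP d)).

Lemma next_dart3 d : next_dart (next_dart (next_dart d)) = d.
Proof.
case: d => [[x y] xy]; apply: val_inj => /=; rewrite (tri_cycle H xy).
by have := tri_cycle H (tri_next H xy); rewrite (tri_cycle H xy) => ->.
Qed.

Lemma next_dart_inj : injective next_dart.
Proof. by move=> d e E; rewrite -(next_dart3 d) E next_dart3. Qed.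

Lemma rev_inj : injective rev.
Proof. by apply: inv_inj => d; apply: val_inj; case: d => [[]]. Qed.

(** The rotation is recovered from the faces: with [rot] equal to [next_dart] after [rev],
    [face_step] becomes [next_dart]. *)
Definition realize_rot : {perm dart G} := perm (inj_comp next_dart_inj rev_inj).

Lemma realize_face_step d : face_step realize_rot d = next_dart d.
Proof.
by rewrite /face_step permE /=; congr next_dart; apply: val_inj; case: d => [[]].
Qed.

Lemma realize_rotation : rotation_system realize_rot.
Proof.
move=> d d'; apply/idP/eqP => [/iter_findex <-|].
  by elim: (findex _ _ _) => //= i ->; rewrite permE.
case: d d' => [[x y] xy] [[x' z]]; rewrite /source /= => xz xx'; subst x'.
have := tri_link H xy xz => /iter_findex; move: (findex _ y z) => i iE.
pose d : dart G := exist (fun p : G * G => adj p.1 p.2) (x, y) xy.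
suff <- : iter i realize_rot d = exist (fun p : G * G => adj p.1 p.2) (x, z) xz.
  exact: fconnect_iter.
apply: val_inj => /=; rewrite -iE; elim: i {z xz iE} => //= i IH.
by rewrite permE /= IH.
Qed.

Lemma realize_faces d : order (face_step realize_rot) d = 3.
Proof.
have fE := realize_face_step.
have nd e : next_dart e != e.
  apply/eqP => /(congr1 val)/(congr1 fst) /= E.
  by case: e E => [[x y] /= xy] E; move: xy; rewrite E (tri_irr H).
apply: (order_cycle (p := [:: d; next_dart d; next_dart (next_dart d)])).
- by rewrite /= !fE next_dart3 !eqxx.
- have n3 : d != next_dart (next_dart d) by rewrite -{1}(next_dart3 d) nd.
  by rewrite /= !inE negb_or n3 (eq_sym d) nd (eq_sym (next_dart d)) nd.
by rewrite inE eqxx.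
Qed.

Lemma realize_euler :
  #|G| + nb_faces realize_rot = #|edges G| + 2.
Proof.
have dE : #|dart G| = npairs a by rewrite /npairs cardsE card_sig.
have eE : 2 * #|edges G| = npairs a.
  rewrite -card_edge_pairs //; apply: eq_card => p; rewrite !inE.
  by case: (boolP (adj _ _)) => [pa|/negPf/=->] //=; rewrite [RHS]pa; apply/imsetP;
    exists p; rewrite ?inE.
have fE : nb_faces realize_rot * 3 = #|dart G|.
  apply: fcard_order_set; last by [].
    by move=> d e; rewrite !realize_face_step; apply: next_dart_inj.
  by apply/subsetP=> d _; rewrite inE realize_faces.
have tc := tri_card H; rewrite (_ : #|G| = #|V|) //.
move: dE eE fE tc; move: (nb_faces realize_rot) (npairs a) #|edges G| #|dart G| #|V|.
clear => *; lia.
Qed.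

Definition realize : plane_triangulation :=
  @PlaneTriangulation G realize_rot realize_rotation (tri_order H)
    (tri_connected H) realize_euler realize_faces.

End Realize.

(** * Inserting a vertex into a face *)

Section Stack.

Variables (V : finType) (a : rel V) (tau : V -> V -> V) (p q r : V).
Hypothesis H : triangulated a tau.
Hypotheses (pq : a p q) (pqr : tau p q = r).

Definition on_face x y := [|| (x == p) && (y == q), (x == q) && (y == r)
                            | (x == r) && (y == p)].

Definition stack_adj (u v : option V) : bool :=
  match u, v with
  | Some x, Some y => a x y
  | None, Some y => y \in [set p; q; r]
  | Some x, None => x \in [set p; q; r]
  | None, None => false
  end.

(** [None] is the new vertex. The three darts of the old face now have it on their left, and the
    other darts between old vertices keep their faces. *)
Definition stack_tau (u v : option V) : option V :=
  match u, v with
  | Some x, Some y => if on_face x y then None else Some (tau x y)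
  | Some x, None => Some (if x == p then r else if x == q then p else q)
  | None, Some y => Some (if y == p then q else if y == q then r else p)
  | None, None => None
  end.

Let qr : a q r. Proof. by rewrite -pqr (tri_next H). Qed.
Let qrp : tau q r = p. Proof. by rewrite -pqr (tri_cycle H). Qed.
Let rp : a r p. Proof. by rewrite -qrp (tri_next H). Qed.
Let rpq : tau r p = q. Proof. by rewrite -qrp (tri_cycle H). Qed.

Let a_neq x y : a x y -> (x == y) = false.
Proof. by move=> xy; apply: contraTF xy => /eqP->; rewrite (tri_irr H). Qed.
Let npq : (p == q) = false := a_neq pq.
Let nqr : (q == r) = false := a_neq qr.
Let nrp : (r == p) = false := a_neq rp.
Let nqp : (q == p) = false. Proof. by rewrite eq_sym. Qed.
Let nrq : (r == q) = false. Proof. by rewrite eq_sym. Qed.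
Let npr : (p == r) = false. Proof. by rewrite eq_sym. Qed.

Lemma stack_sym : symmetric stack_adj.
Proof. by move=> [x|] [y|] //=; apply: tri_sym H _ _. Qed.

Lemma stack_irr : irreflexive stack_adj.
Proof. by move=> [x|] //=; apply: tri_irr H _. Qed.

Lemma stack_next u v : stack_adj u v -> stack_adj v (stack_tau u v).
Proof.
case: u v => [x|] [y|] //=.
- case: ifP => [/or3P[]/andP[_ /eqP->] _|_]; rewrite ?inE ?eqxx ?orbT //.
  exact: (tri_next H).
- by rewrite !inE; case: ifP => _; [|case: ifP]; rewrite eqxx ?orbT.
rewrite !inE => /orP[/orP[]|]/eqP->; rewrite ?eqxx ?nqp ?nrp ?nrq //.
Qed.

Lemma stack_cycle u v : stack_adj u v -> stack_tau v (stack_tau u v) = u.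
Proof.
case: u v => [x|] [y|] //=.
- case: ifP => [/or3P[]/andP[/eqP-> /eqP->] _|nf xy] /=.
  + by rewrite nqp eqxx.
  + by rewrite nrp nrq.
  + by rewrite eqxx.
  rewrite (tri_cycle H xy); case: ifP => // f; case/negP: nf; rewrite /on_face.
  have := tri_cycle H xy; case/or3P: f => /andP[/eqP yE /eqP ->].
  + by rewrite yE pqr => <-; rewrite !eqxx !orbT.
  + by rewrite yE qrp => <-; rewrite !eqxx.
  + by rewrite yE rpq => <-; rewrite !eqxx !orbT.
- rewrite !inE => /orP[/orP[]|]/eqP->; do 2?rewrite ?eqxx ?nqp ?nrp ?nrq /=;
  rewrite ?eqxx ?nqp ?nrp ?nrq //.
rewrite !inE => /orP[/orP[]|]/eqP->; do 2?rewrite ?eqxx ?nqp ?nrp ?nrq /=;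
  rewrite /on_face ?eqxx ?orbT //.
Qed.

(** Around an old vertex, each old step remains a step or becomes two steps through [None], so old
    neighbours stay linked; [None] itself has the cycle of [p], [r], [q]. *)
Lemma stack_link w u v : stack_adj w u -> stack_adj w v -> fconnect (stack_tau^~ w) u v.
Proof.
case: w => [w|]; last first.
  have s1 : fconnect (stack_tau^~ None) (Some p) (Some r).
    by apply: connect1; rewrite /= eqxx.
  have s2 : fconnect (stack_tau^~ None) (Some r) (Some q).
    by apply: connect1; rewrite /= nrp nrq.
  have s3 : fconnect (stack_tau^~ None) (Some q) (Some p).
    by apply: connect1; rewrite /= nqp eqxx.
  have toq x : x \in [set p; q; r] -> fconnect (stack_tau^~ None) (Some x) (Some q).
    rewrite !inE => /orP[/orP[]|]/eqP->; [exact: connect_trans s1 s2|exact: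
      connect0|exact: s2].
  have fromq x : x \in [set p; q; r] -> fconnect (stack_tau^~ None) (Some q) (Some x).
    rewrite !inE => /orP[/orP[]|]/eqP->; [exact: s3|exact: connect0|exact:
      connect_trans s3 s1].
  by case: u v => [x|] [y|] //= /toq xq /fromq; apply: connect_trans.
have step x : fconnect (stack_tau^~ (Some w)) (Some x) (Some (tau x w)).
  case: (boolP (on_face x w)) => [f|nf]; last first.
    by apply: connect1; rewrite /= (negPf nf).
  apply: (@connect_trans _ _ None); first by apply: connect1; rewrite /= f.
  apply: connect1; rewrite /=; apply/eqP; congr Some.
  case/or3P: f => /andP[/eqP-> /eqP->]; rewrite ?pqr ?qrp ?rpq ?nqp ?nrp ?nrq ?eqxx //.
have lift x y : a w x -> a w y -> fconnect (stack_tau^~ (Some w)) (Some x) (Some y).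
  move=> wx wy; have := tri_link H wx wy => /iter_findex.
  move: (findex _ x y) => i <-; elim: i => [|i IH]; first exact: connect0.
  by rewrite iterS; apply: connect_trans IH (step _).
have toNone x : a w x -> w \in [set p; q; r] -> fconnect (stack_tau^~ (Some w))
  (Some x) None.
  have pred y : on_face y w -> fconnect (stack_tau^~ (Some w)) (Some y) None.
    by move=> f; apply: connect1; rewrite /= f.
  move=> wx; rewrite !inE => /orP[/orP[]|]/eqP wE.
  - apply: (connect_trans (lift x r wx _) (pred r _)).
      by rewrite wE (tri_sym H).
    by rewrite /on_face wE !eqxx !orbT.
  - apply: (connect_trans (lift x p wx _) (pred p _)).
      by rewrite wE (tri_sym H).
    by rewrite /on_face wE !eqxx.
  apply: (connect_trans (lift x q wx _) (pred q _)).
    by rewrite wE (tri_sym H).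
  by rewrite /on_face wE !eqxx !orbT.
have fromNone y : a w y -> w \in [set p; q; r] -> fconnect (stack_tau^~ (Some w))
  None (Some y).
  move=> wy wF; have aN : a w (if w == p then q else if w == q then r else p).
    move: wF; rewrite !inE => /orP[/orP[]|]/eqP->; rewrite ?eqxx ?nqp ?nrp ?nrq //.
  by apply: connect_trans (lift _ y aN wy); apply: connect1; rewrite /= eqxx.
case: u v => [x|] [y|] //=.
- exact: lift.
- exact: toNone.
- by move=> wF wy; apply: fromNone.
Qed.

Lemma stack_connected u v : connect stack_adj u v.
Proof.
have lift x y : connect stack_adj (Some x) (Some y).
  have /connectP[s] := tri_connected H x y.
  elim: s x => [|z s IH] x /= => [_ ->|]; first exact: connect0.
  by case/andP=> xz /IH h /h; apply: connect_trans; apply: connect1.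
have Np : stack_adj None (Some p) by rewrite /= !inE eqxx.
have pN : stack_adj (Some p) None by rewrite /= !inE eqxx.
case: u v => [x|] [y|] //.
- exact: connect_trans (lift x p) (connect1 pN).
- exact: connect_trans (connect1 Np) (lift p y).
Qed.

Lemma card_stack_pairs (Q : pred (option V * option V)) :
  #|[set e | stack_adj e.1 e.2 && Q e]| =
  #|[set e | a e.1 e.2 && Q (Some e.1, Some e.2)]|
  + #|[set x in [set p; q; r] | Q (None, Some x)]|
  + #|[set x in [set p; q; r] | Q (Some x, None)]|.
Proof.
pose f1 (e : V * V) := (Some e.1, Some e.2).
pose f2 (x : V) : option V * option V := (None, Some x).
pose f3 (x : V) : option V * option V := (Some x, None).
have i1 : injective f1 by move=> [x y] [z t] [-> ->].
have i2 : injective f2 by move=> x y [].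
have i3 : injective f3 by move=> x y [].
rewrite -(card_imset (mem [set e | a e.1 e.2 && Q (Some e.1, Some e.2)]) i1).
rewrite -(card_imset (mem [set x in [set p; q; r] | Q (None, Some x)]) i2).
rewrite -(card_imset (mem [set x in [set p; q; r] | Q (Some x, None)]) i3).
set A1 := f1 @: _; set A2 := f2 @: _; set A3 := f3 @: _.
have -> : [set e | stack_adj e.1 e.2 && Q e] = A1 :|: A2 :|: A3.
  apply/setP=> e; rewrite !in_setU; apply/idP/idP.
    rewrite inE; case: e => [[x|] [y|]] //= /andP[xy Qe].
    - by apply/orP; left; apply/orP; left; apply/imsetP; exists (x, y);
      rewrite ?inE ?xy.
    - by apply/orP; right; apply/imsetP; exists x => //; apply/setIdP.
    by apply/orP; left; apply/orP; right; apply/imsetP; exists y => //; apply/setIdP.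
  case/orP=> [/orP[]|] /imsetP[x].
  - by rewrite !inE /= => /andP[xy Qx] ->; rewrite /= xy.
  - by case/setIdP=> xF Qx ->; rewrite inE [stack_adj _ _]xF.
  by case/setIdP=> xF Qx ->; rewrite inE [stack_adj _ _]xF.
have d12 : A1 :&: A2 = set0.
  by apply/setP=> e; rewrite in_setI in_set0; apply/andP=>
    -[/imsetP[x _ ->] /imsetP[y _]].
have d13 : A1 :&: A3 = set0.
  by apply/setP=> e; rewrite in_setI in_set0; apply/andP=>
    -[/imsetP[x _ ->] /imsetP[y _]].
have d23 : A2 :&: A3 = set0.
  by apply/setP=> e; rewrite in_setI in_set0; apply/andP=>
    -[/imsetP[x _ ->] /imsetP[y _]].
by rewrite cardsU setIUl d13 d23 setU0 cards0 subn0 cardsU d12 cards0 subn0.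
Qed.

Lemma stack_triangulated : triangulated stack_adj stack_tau.
Proof.
split; [exact: stack_sym | exact: stack_irr | exact: stack_next | exact: stack_cycle
      | exact: stack_link | exact: stack_connected | |].
  have -> : npairs stack_adj = #|[set e | stack_adj e.1 e.2 && predT e]|.
    by apply: eq_card => e; rewrite !inE andbT.
  rewrite card_stack_pairs card_option.
  have -> : #|[set x in [set p; q; r] | predT ((None, Some x) :
    option V * option V)]| = 3.
    rewrite (_ : [set x in _ | _] = [set p; q; r]); last by apply/setP=> x;
      rewrite !inE andbT.
    by rewrite -setUA cardsU1 cards2 !inE npq npr nqr.
  have -> : #|[set e : V * V | a e.1 e.2 && predT (Some e.1, Some e.2)]| = npairs a.
    by apply: eq_card => e; rewrite !inE andbT.
  by have := tri_card H; move: (npairs a) #|V|; clear => *; lia.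
by rewrite card_option; apply: leq_trans (tri_order H) (leqnSn _).
Qed.

Definition pairs_touching (W : finType) (b : rel W) (S : {set W}) :=
  #|[set e : W * W | b e.1 e.2 && ((e.1 \in S) || (e.2 \in S))]|.

(** Of the three new edges, those to [p] and [q] touch [S], giving four ordered pairs. *)
Lemma stack_touching (S : {set V}) : p \in S -> q \in S -> r \notin S ->
  pairs_touching stack_adj (Some @: S) = pairs_touching a S + 4.
Proof.
move=> pS qS rS; rewrite /pairs_touching card_stack_pairs.
have SS x : (Some x \in Some @: S) = (x \in S) by rewrite mem_imset //; move=> ? ? [].
have NS : (None \in Some @: S) = false by apply/imsetP=> -[].
have E : [set x in [set p; q; r] | x \in S] = [set p; q].
  apply/setP=> x; rewrite !inE; case: (altP (x =P p)) => [->|_] //=.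
  by case: (altP (x =P q)) => [->|_] //=; case: eqP => [->|]; rewrite // (negPf rS).
have -> : #|[set x in [set p; q; r] | (None \in Some @: S) || (Some x \in Some @:
  S)]| = 2.
  rewrite (_ : [set x in _ | _] = [set p; q]) ?cards2 ?npq // -[RHS]E.
  by apply/setP=> x; rewrite !inE NS SS.
have -> : #|[set x in [set p; q; r] | (Some x \in Some @: S) || (None \in Some @:
  S)]| = 2.
  rewrite (_ : [set x in _ | _] = [set p; q]) ?cards2 ?npq // -[RHS]E.
  by apply/setP=> x; rewrite !inE NS SS orbF.
rewrite -addnA; congr (_ + _); apply: eq_card => e; rewrite !inE.
by rewrite !SS.
Qed.

End Stack.

(** * The lower bound *)

Section Base.

(* [K_4] on the vertices 0, 1, 2, 3 with one further vertex inside each of its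
   four faces; entry [y] of row [x] is the third vertex of the face to the left
   of [(x, y)], and 8 when [x] and [y] are not adjacent. *)
Definition base_table : seq (seq nat) :=
  [:: [:: 8; 4; 5; 6; 2; 3; 1; 8]; [:: 6; 8; 4; 7; 0; 8; 3; 2];
      [:: 4; 7; 8; 5; 1; 0; 8; 3]; [:: 5; 6; 7; 8; 8; 2; 0; 1];
      [:: 1; 2; 0; 8; 8; 8; 8; 8]; [:: 2; 8; 3; 0; 8; 8; 8; 8];
      [:: 3; 0; 8; 1; 8; 8; 8; 8]; [:: 8; 3; 1; 2; 8; 8; 8; 8]].

Definition base_next (x y : nat) : nat := nth 8 (nth [::] base_table x) y.
Definition base_adj : rel 'I_8 := fun x y => base_next x y < 8.
Definition base_tau (x y : 'I_8) : 'I_8 := inord (base_next x y).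

(** Claims about the table become evaluations over natural numbers. *)
Lemma base_check2 (P : nat -> nat -> bool) :
  all (fun x => all (P x) (iota 0 8)) (iota 0 8) -> forall x y : 'I_8, P x y.
Proof.
move=> /allP h x y; have /h/allP h' : (x : nat)
  \in iota 0 8 by rewrite mem_iota ltn_ord.
by apply: h'; rewrite mem_iota ltn_ord.
Qed.

Lemma base_check3 (P : nat -> nat -> nat -> bool) :
  all (fun x => all (fun y => all (P x y) (iota 0 8)) (iota 0 8)) (iota 0 8) ->
  forall x y z : 'I_8, P x y z.
Proof.
move=> /allP h x y z; have /h h' : (x : nat) \in iota 0 8 by rewrite mem_iota ltn_ord.
exact: (base_check2 (P := P x) h' y z).
Qed.

Lemma base_tauE (x y : 'I_8) : base_adj x y -> base_tau x y = base_next x y :> nat.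
Proof. exact: inordK. Qed.

Lemma card_base_pairs (P : nat -> nat -> bool) :
  #|[set e : 'I_8 * 'I_8 | P e.1 e.2]| = sumn [seq sumn [seq (P i j : nat)
    | j <- iota 0 8] | i <- iota 0 8].
Proof.
have sumE (F : nat -> nat) : sumn [seq F i | i <- iota 0 8] = \sum_(i < 8) F i.
  by rewrite sumnE big_map -(big_mkord xpredT F) /index_iota subn0.
rewrite sumE; under [RHS]eq_bigr => i _ do rewrite sumE.
rewrite pair_bigA -sum1_card big_mkcond; apply: eq_bigr => e _.
by rewrite inE; case: P.
Qed.

Lemma base_next_adj (x y : 'I_8) : base_adj x y -> base_adj y (base_tau x y).
Proof.
move=> xy; rewrite /base_adj base_tauE //; move: xy; apply/implyP.
exact: (base_check2 (P := fun x y => (base_next x y < 8) ==>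
  (base_next y (base_next x y) < 8)) isT x y).
Qed.

Lemma base_triangulated : triangulated base_adj base_tau.
Proof.
have sym : symmetric base_adj.
  move=> x y; apply/(@eqP bool).
  exact: (base_check2 (P := fun x y => (base_next x y < 8) == (base_next y x < 8))
    isT x y).
split=> //.
- move=> x; apply/negbTE.
  exact: (base_check2 (P := fun x _ => ~~ (base_next x x < 8)) isT x x).
- exact: base_next_adj.
- move=> x y xy; apply: val_inj; rewrite /= base_tauE ?base_next_adj // base_tauE //.
  apply/eqP; move: xy; apply/implyP.
  exact: (base_check2 (P := fun x y => (base_next x y < 8) ==>
    (base_next y (base_next x y) == x)) isT x y).
- move=> v x y vx vy.
  have : has (fun i => iter i (base_next^~ v) x == y) (iota 0 8).
    move: vy; apply/implyP; move: vx; apply/implyP.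
    exact: (base_check3 (P := fun v x y => (base_next v x < 8) ==>
      ((base_next v y < 8) ==>
      has (fun i => iter i (base_next^~ v) x == y) (iota 0 8))) isT v x y).
  case/hasP=> i _ /eqP iE.
  suff -> : y = iter i (base_tau^~ v) x by apply: fconnect_iter.
  have [_ e] : base_adj (iter i (base_tau^~ v) x) v /\
      iter i (base_tau^~ v) x = iter i (base_next^~ v) x :> nat.
    elim: i {iE} => [|i [ai ei]] /=; first by rewrite sym.
    by rewrite sym base_next_adj // base_tauE // ei.
  by apply: ord_inj; rewrite e iE.
- move=> x y; have : has (fun z => (base_next x z < 8) && (base_next z y < 8))
  (iota 0 8).
    exact: (base_check2 (P := fun x y => has (fun z => (base_next x z < 8) &&
      (base_next z y < 8)) (iota 0 8)) isT x y).
  case/hasP=> z; rewrite mem_iota => /= z8 /andP[xz zy].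
  by apply: (@connect_trans _ _ (Ordinal z8)); apply: connect1.
- by rewrite /npairs (card_base_pairs (fun x y => base_next x y < 8)) card_ord.
by rewrite card_ord.
Qed.

(** All 18 edges touch the [K_4], since the four inner vertices are pairwise nonadjacent. *)
Lemma card_base_touching :
  pairs_touching base_adj [set x : 'I_8 | x < 4] = 36.
Proof.
rewrite -[RHS](card_base_pairs (fun x y => (base_next x y < 8) && ((x < 4)
  || (y < 4)))).
by apply: eq_card => e; rewrite !inE.
Qed.

End Base.

(** Vertices are stacked repeatedly to the left of the same dart [(p, q)] inside [S]: the new vertex
    becomes the third vertex of that face and lies outside [S], so each step adds two edges touching
    [S]. *)
Lemma extremal_triangulation m : exists (V : finType) (a : rel V) tau (S : {set V}) p q,
  [/\ triangulated a tau, #|V| = m + 8, #|S| = 4,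
      pairs_touching a S = 2 * (2 * (m + 8) + 2) &
      [/\ a p q, p \in S, q \in S & tau p q \notin S]].
Proof.
elim: m => [|m [V [a [tau [S [p [q [H cV cS cT [pq pS qS rS]]]]]]]]].
  have lt k : k < 8 -> val (inord k : 'I_8) = k by apply: inordK.
  exists 'I_8, base_adj, base_tau, [set x : 'I_8 | x < 4], (inord 0), (inord 1).
  have pq : base_adj (inord 0) (inord 1) by rewrite /base_adj !lt.
  split; [exact: base_triangulated | by rewrite card_ord | | exact:
    card_base_touching |].
    rewrite -sum1_card big_mkcond /=; under eq_bigr => e _ do rewrite inE.
    by rewrite -(big_mkord xpredT (fun i => if i < 4 then 1 else 0)) unlock.
  by split; rewrite ?inE ?base_tauE // ?lt.
have H' := stack_triangulated H pq erefl.
have i : injective (@Some V) by move=> x y [].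
exists (option V), (stack_adj a p q (tau p q)), (stack_tau tau p q (tau p q)),
  (Some @: S), (Some p), (Some q).
split=> //.
- by rewrite card_option cV.
- by rewrite card_imset.
- by rewrite (stack_touching H pq) // cT; lia.
by split=> //=; rewrite ?mem_imset // /on_face !eqxx; apply/imsetP => -[].
Qed.

(** Greedy choice: the at most ten vertices used so far leave an edge free, by [edge_avoiding]. *)
Lemma contains_matching6 (T : plane_triangulation) :
  30 <= #|T| -> contains T (matching 6).
Proof.
move=> T30.
suff [s [us sadj sz]] : exists s : seq (T * T),
    [/\ uniq (map fst s ++ map snd s), {in s, forall p, adj p.1 p.2} & size s == 6].
  have [||//|f [ef _]] := @rainbow_of_tuple T _ id _ (Tuple sz) => //=;
    last by exists f.
  rewrite map_inj_in_uniq; last by move=> p q ps qs; apply: uniq_pair_set us ps qs.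
  by move: us; rewrite cat_uniq => /andP[/map_uniq].
suff gen k : k <= 6 -> exists s : seq (T * T),
    [/\ uniq (map fst s ++ map snd s), {in s, forall p, adj p.1 p.2} & size s == k].
  exact: gen.
elim: k => [_|k IH k6]; first by exists [::].
have [s [us sadj /eqP sz]] := IH (ltnW k6).
pose K := [set x in map fst s ++ map snd s].
have cK : #|K| <= 10.
  rewrite cardsE; apply: leq_trans (card_size _) _.
  by rewrite size_cat !size_map sz; move: k6; clear; lia.
have [||x [y [xy xK yK]]] := @edge_avoiding T K.
- by move: cK T30; clear; move: #|K| #|T| => *; lia.
- by move: T30; clear; move: #|T| => *; lia.
exists ((x, y) :: s); split; last by rewrite /= sz.
  have nxy : x != y by apply: contraTneq xy => ->; rewrite adj_irrefl.
  have perm : perm_eq ((x :: map fst s) ++ (y :: map snd s))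
      (x :: y :: (map fst s ++ map snd s)).
    by apply/seq.permP=> P; rewrite /= !count_cat /=; lia.
  rewrite (perm_uniq perm) /= us andbT inE negb_or nxy /=.
  by apply/andP; split; [apply: contra xK | apply: contra yK]; rewrite in_set.
by move=> p; rewrite inE => /orP[/eqP->|/sadj].
Qed.

Lemma lower_bound n : 30 <= n -> colors_avoiding n (matching 6) (2 * n + 3).
Proof.
move=> n30; have n8 : n = (n - 8) + 8 by move: n30; clear; lia.
have [V [a [tau [S0 [p [q [H cV cS cT _]]]]]]] := extremal_triangulation (n - 8).
rewrite -n8 in cV cT.
pose T := realize H; pose S : {set T} := S0; have {}cS : #|S| = 4 by [].
exists T; split; first by split=> //; apply: contains_matching6; rewrite cV.
pose F := [set e in edges T | e :&: S != set0].
have FT : F \subset edges T by apply/subsetP=> e; rewrite inE => /andP[].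
have cF : #|F| = 2 * n + 2.
  have : 2 * #|F| = 2 * (2 * n + 2).
    rewrite -cT -card_edge_pairs //; apply: eq_card => e; rewrite !inE.
    case: (boolP (a e.1 e.2)) => [ae|/negPf ae]; last by rewrite [adj _ _]ae.
    rewrite [adj _ _]ae /=; have -> : [set e.1; e.2] \in edges T.
      by apply/imsetP; exists e; rewrite ?inE.
    apply/set0Pn/orP => [[x]|].
      by rewrite !inE => /andP[/orP[]/eqP-> ->]; auto.
    by case=> eS; [exists e.1 | exists e.2]; rewrite !inE eqxx ?orbT eS.
  by move: #|F|; clear; lia.
(* All edges outside [F] have index [size (enum F)], which serves as the one further colour. *)
have lt e : index e (enum F) < 2 * n + 3.
  by rewrite addnS ltnS -cF cardE index_size.
pose c e : 'I_(2 * n + 3) := Ordinal (lt e).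
exists c; split.
  move=> i; case: (ltnP i (2 * n + 2)) => iF.
    have iF' : i < size (enum F) by rewrite -cardE cF.
    have eF := mem_nth set0 iF'; rewrite mem_enum in eF.
    exists (nth set0 (enum F) i); first exact: (subsetP FT).
    by apply: val_inj; rewrite /= index_uniq ?enum_uniq.
  (* The further colour occurs because [3n - 6] exceeds [2n + 2]. *)
  have : F \proper edges T.
    rewrite properEcard FT cF; have := card_edges T; have := card_dart T; rewrite cV.
    by move: #|edges T| #|dart T| n30; clear => *; lia.
  case/properP=> _ [e eT eF]; exists e => //; apply: val_inj => /=.
  rewrite memNindex ?mem_enum // -cardE cF.
  by have := ltn_ord i; move: iF; move: (i : nat); clear => *; lia.
case=> f [[finj fadj] cinj].
pose ed (i : 'I_6) : {set matching 6} := [set (i, false); (i, true)].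
have edE i : ed i \in edges (matching 6).
  by apply/imsetP; exists ((i, false), (i, true));
    rewrite // inE /= /matching_adj !eqxx.
have ed_inj : injective ed.
  move=> i j E; have : (i, false) \in ed j by rewrite -E !inE eqxx.
  by rewrite !inE !xpair_eqE andbF orbF andbT => /eqP.
pose J := [set i | f @: ed i \in F].
(* Two edges outside [F] would share a colour, so at most one of the six is outside. *)
have J5 : 5 <= #|J|.
  suff : #|~: J| <= 1 by have := cardsC J; rewrite card_ord; move: #|J| #|~: J|;
    clear; lia.
  apply/card_le1_eqP => i j iJ jJ.
  apply: ed_inj; apply: cinj => //; apply: val_inj => /=.
  have out l : l \in ~: J -> index (f @: ed l) (enum F) = size (enum F).
    by rewrite !in_set => lF; apply: memNindex; rewrite mem_enum in_set.
  by rewrite !out.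
(* An end in [S] of each edge in [F]; disjoint edges have different ends, so [S] would need five
   vertices. *)
pose h (i : 'I_6) := f (i, f (i, true) \in S).
have hS i : i \in J -> h i \in S.
  rewrite !inE => /andP[_ /set0Pn[x]]; rewrite inE => /andP[/imsetP[u]].
  rewrite /ed /h in_set2 => /orP[]/eqP-> -> uS; last by rewrite uS.
  by case E: (f (i, true) \in S).
have : #|J| <= #|S|.
  rewrite -(card_in_imset (f := h)); last by move=> i j _ _ /finj[].
  by apply/subset_leq_card/subsetP=> _ /imsetP[i iJ ->]; apply: hS.
by rewrite cS; move: J5; move: #|J|; clear; lia.
Qed.

Theorem theorem4 (n : nat) (hn : 30 <= n) :
  is_planar_anti_ramsey n (matching 6) (2 * n + 3).
Proof.
split; first exact: lower_bound.
move=> k [T [[Tn _] [c [conto norb]]]]; rewrite leqNgt; apply/negP => k_big.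
by apply: norb; apply: rainbow_exists conto _; rewrite Tn // -addnS in k_big *.
Qed.
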